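(* Consider the growing-sample-size model described in the context. Assume that the function $g$ is in $\mathcal C^{(1)}[0,1]$ and monotonically increasing throughout $[0,1]$, with $g(0)>0$ and $g(1)<1$, and that the function $\hat G:[0,1]\to\mathbb R$, defined as $$\hat G(q)=q(1-q)\{2g(q)-1\}+\alpha\{g(q)-q\}\quad\text{for all }q\in[0,1],$$ has a unique root, say $q^*$, in $[0,1]$. In addition to the constraints $$0<\eta_1=\inf_{n\ge N}\frac{s_{n+1}}{(n+1)k_n}\le\sup_{n\ge N}\frac{s_{n+1}}{(n+1)k_n}=\eta_2<\infty$$ on $\eta_1$ and $\eta_2$, assume that $\eta_2\le1$, and, letting $\upsilon=\sup\{g'(q):q\in[0,1]\}$, assume that $$0<\upsilon\le\min\{2,\ (1+\sqrt5)(1-\eta_1)^{-1}\eta_1\}.$$ Then the sequence $\{(n^{-1}A_n,s_n^{-1}B_n,s_n^{-1}C_n)\}$ converges almost surely to a compact, connected, internally chain transitive invariant set, corresponding to the differential inclusion $(\dot a(t),\dot b(t),\dot c(t))\in F(a(t),b(t),c(t))$ for $t\ge0$, where $$F(a,b,c)=\big\{(\eta\hat h_1(a,b,c),\hat h_2(a,b,c),\hat h_3(a,b,c)):\eta\in[\eta_1,\eta_2]\big\},\qquad (a,b,c)\in\hat{\mathcal S},$$ contained in the set $$\hat\Lambda=\{(a,b,c)\in\hat{\mathcal S}:q_\alpha(a,b,c)=q^*,\ a=g(q^* )\}.$$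
   Context: **Model (growing sample size).** Fix an integer $N\ge1$, a sequence $\{k_n:n\ge N\}$ of positive integers growing with $n$, a constant $\alpha>0$, a memory parameter $p\in[0,1]\setminus\{1/2\}$ and a reinforcement function $f:[0,1]\to[0,1]$. Put $g(x)=pf(x)+(1-p)\{1-f(x)\}$ for $x\in[0,1]$ (so $g:[0,1]\to[0,1]$), $s_n=\sum_{i=N+1}^nk_{i-1}$ for $n\ge N+1$, and let $\{\beta_n:n\ge N\}$ be positive reals with $n\beta_n=\alpha s_n$ for all $n\ge N+1$. $G_N$ is the graph with vertices $v_1,\dots,v_N$ and no edges; each $v_i$ ($i\le N$) has an arbitrary state $X_i\in\{+1,-1\}$. For $n\ge N$, given the $\sigma$-field $\mathcal F_n$ of all information up to and including epoch $n$ (the directed multigraph $G_n$ on $v_1,\dots,v_n$, its states and its history), a new vertex $v_{n+1}$ arrives and indices $U_{n,1},\dots,U_{n,k_n}$ are drawn with replacement, i.i.d. given $\mathcal F_n$, with $$\mathbf P[U_{n,1}=m\mid\mathcal F_n]=\frac{\mathrm{indeg}_n(v_m)+\beta_n}{\sum_{j=1}^n\mathrm{indeg}_n(v_j)+n\beta_n},\quad m\in\{1,\dots,n\},$$ where $\mathrm{indeg}_n(v)$ is the in-degree of $v$ in $G_n$, counted with multiplicity. Let $P_n=\#\{i\le k_n:X_{U_{n,i}}=+1\}$. Given $\mathcal F_n$ and the sample, $X_{n+1}=+1$ with probability $g(P_n/k_n)$ and $X_{n+1}=-1$ with probability $1-g(P_n/k_n)$. Then for each $i\in\{1,\dots,k_n\}$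 with $X_{U_{n,i}}=X_{n+1}$ a directed edge from $v_{n+1}$ to $v_{U_{n,i}}$ is added (repeated edges kept), giving $G_{n+1}$. States never change afterwards. **Statistics.** $A_n=\#\{i\le n:X_i=+1\}$, $B_n=\sum_{i\le n,\,X_i=+1}\mathrm{indeg}_n(v_i)$, $C_n=\sum_{i\le n}\mathrm{indeg}_n(v_i)$. **Drift.** $\hat{\mathcal S}=\{(a,b,c)\in[0,1]^3:c\ge b\}$; $q_\alpha=q_\alpha(a,b,c)=\frac{b+\alpha a}{c+\alpha}\in[0,1]$; on $\hat{\mathcal S}$, $\hat h_1(a,b,c)=g(q_\alpha)-a$, $\hat h_2(a,b,c)=q_\alpha g(q_\alpha)-b$, $\hat h_3(a,b,c)=q_\alpha g(q_\alpha)+(1-q_\alpha)\{1-g(q_\alpha)\}-c$. **Function class.** $\mathcal C^{(1)}[0,1]$ is the set of functions on $[0,1]$ that extend to a function on an open set containing $[0,1]$ whose first derivative exists and is continuous there. **Differential inclusions.** A solution of $\dot{\mathbf x}\in F(\mathbf x)$ with initial value $\mathbf u$ is an absolutely continuous map $\mathbf x$ with $\mathbf x(0)=\mathbf u$ and $\dot{\mathbf x}(t)\in F(\mathbf x(t))$ for almost every $t$. A set $A$ is *invariant* if for every $\mathbf u\in A$ there is at least one solution $\mathbf x$ with $\mathbf x(0)=\mathbf u$ and $\mathbf x(t)\in A$ for each $t\in\mathbb R$. A compact set $A$ is *internally chain transitive* if for all $\epsilon>0$, $T>0$, $\mathbf u,\mathbf v\in A$ there are $m\ge1$, points $\mathbf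 u_0=\mathbf u,\mathbf u_1,\dots,\mathbf u_m=\mathbf v$ in $A$, solutions $\mathbf x_i$ with $\mathbf x_i(0)=\mathbf u_{i-1}$, and times $t_1,\dots,t_m>T$ such that, for each $i\in\{1,\dots,m\}$, $\mathbf x_i(s)\in A$ for all $0\le s\le t_i$ and $\|\mathbf x_i(t_i)-\mathbf u_i\|<\epsilon$. A sequence $z_n$ converges to a set $L$ if $\inf_{\mathbf w\in L}\|z_n-\mathbf w\|\to0$. *)

(* Defs.v *)
From HB Require Import structures.
From mathcomp Require Import all_boot all_order all_algebra.
From mathcomp Require Import all_classical all_reals all_analysis.

Set Implicit Arguments.
Unset Strict Implicit.
Unset Printing Implicit Defensive.

Import Order.TTheory GRing.Theory Num.Theory.
Import numFieldNormedType.Exports.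

Local Open Scope classical_set_scope.
Local Open Scope ring_scope.

Section Calculus01.
Context {R : realType}.
Implicit Types (g : R -> R).

Definition C1_on01 g : Prop :=
  exists (O : set R) (gt : R -> R),
    [/\ open O, `[0, 1]%classic `<=` O,
        forall x, x \in `[0, 1] -> gt x = g x,
        forall x, O x -> derivable gt x 1 &
        forall x, O x -> {for x, continuous (derive1 gt)}].

(* Derivative relative to [0, 1], hence one-sided at 0 and 1; it does not depend
   on the values of g outside [0, 1]. *)
Definition deriv01 g (q : R) : R :=
  lim ((g x - g q) / (x - q) @[x --> within `[0, 1]%classic q^']).

End Calculus01.

Section DifferentialInclusion.
Context {R : realType} {V : normedModType R}.
Implicit Types (F : V -> set V) (x : R -> V) (A : set V).

(* The finite families of non-overlapping intervals [u, v] in [a, b] are listed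
   from left to right. *)
Definition abs_continuous (a b : R) x : Prop :=
  forall e : R, 0 < e -> exists2 d : R, 0 < d &
    forall s : seq (R * R),
      all (fun I => [&& a <= I.1, I.1 <= I.2 & I.2 <= b]) s ->
      pairwise (fun I J => I.2 <= J.1) s ->
      \sum_(I <- s) (I.2 - I.1) < d ->
      \sum_(I <- s) `|x I.2 - x I.1| < e.

(* D is the time interval on which x solves the inclusion. *)
Definition is_solution F (D : set R) x (u : V) : Prop :=
  [/\ x 0 = u,
      forall a b : R, a <= b -> `[a, b]%classic `<=` D -> abs_continuous a b x &
      {ae lebesgue_measure, forall t : R, D t ->
         derivable x t 1 /\ F (x t) (derive1 x t)}].

Definition invariant_set F A : Prop :=
  forall u, A u -> exists2 x, is_solution F setT x u & forall t, A (x t).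

Definition chain_transitive F A : Prop :=
  forall (e T : R) (u v : V), 0 < e -> 0 < T -> A u -> A v ->
  exists (m : nat) (w : nat -> V) (x : nat -> R -> V) (t : nat -> R),
    [/\ (0 < m)%N, w 0%N = u, w m = v,
        forall i, (i <= m)%N -> A (w i) &
        forall i, (i < m)%N ->
          [/\ is_solution F `[0, +oo[%classic (x i) (w i),
              T < t i,
              forall r, 0 <= r <= t i -> A (x i r) &
              `|x i (t i) - w i.+1| < e]].

(* The infimum is taken in the extended reals, so that it is +oo when L is
   empty. *)
Definition cvg_to_set (z : nat -> V) (L : set V) : Prop :=
  ereal_inf [set `|z n - w|%:E | w in L] @[n --> \oo] --> (0 : R)%:E.

End DifferentialInclusion.

Section Drift.
Context {R : realType}.
Implicit Types (g : R -> R) (alpha : R) (z : R * R * R).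

Definition reinf (p : R) (f : R -> R) (x : R) : R :=
  p * f x + (1 - p) * (1 - f x).

Definition Shat : set (R * R * R) :=
  [set z | let: (a, b, c) := z in
     [/\ a \in `[0, 1], b \in `[0, 1], c \in `[0, 1] & b <= c]].

Definition qfun alpha z : R :=
  let: (a, b, c) := z in (b + alpha * a) / (c + alpha).

Definition h1 g alpha z : R :=
  let: (a, b, c) := z in let q := qfun alpha z in g q - a.

Definition h2 g alpha z : R :=
  let: (a, b, c) := z in let q := qfun alpha z in q * g q - b.

Definition h3 g alpha z : R :=
  let: (a, b, c) := z in let q := qfun alpha z in
  q * g q + (1 - q) * (1 - g q) - c.

(* Empty outside Shat: solutions have to remain in Shat. *)
Definition Fhat g alpha (eta1 eta2 : R) z : set (R * R * R) :=
  [set v | Shat z /\ exists2 eta : R, eta1 <= eta <= eta2 &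
     v = (eta * h1 g alpha z, h2 g alpha z, h3 g alpha z)].

Definition Ghat g alpha (q : R) : R :=
  q * (1 - q) * (2 * g q - 1) + alpha * (g q - q).

Definition Lambdahat g alpha (qs : R) : set (R * R * R) :=
  [set z | [/\ Shat z, qfun alpha z = qs & z.1.1 = g qs]].

End Drift.

(* Vertices are numbered from 1; X i is the state of v_i, with true for +1 and
   false for -1. The draws made at epoch n are U n i for i < k n. *)
Section Model.
Context {R : realType} {d : measure_display} {T : measurableType d}.
Variables (P : probability T R) (N : nat) (k : nat -> nat).
Variables (X : nat -> {RV P >-> bool}) (U : nat -> nat -> {RV P >-> nat}).

Definition s_ (n : nat) : nat := \sum_(N.+1 <= i < n.+1) k i.-1.

(* The directed edges (source, target) created when v_(n+1) arrives. *)
Definition new_edges (n : nat) (w : T) : seq (nat * nat) :=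
  [seq (n.+1, U n i w) | i <- iota 0 (k n) & X (U n i w) w == X n.+1 w].

(* The edges of G_n, with multiplicity. *)
Definition edges (n : nat) (w : T) : seq (nat * nat) :=
  flatten [seq new_edges j w | j <- iota N (n - N)].

Definition indeg (n v : nat) (w : T) : nat :=
  count (fun e => e.2 == v) (edges n w).

Definition A_ (n : nat) (w : T) : nat := \sum_(1 <= i < n.+1) (X i w : nat).

Definition B_ (n : nat) (w : T) : nat :=
  \sum_(1 <= i < n.+1 | X i w) indeg n i w.

Definition C_ (n : nat) (w : T) : nat := \sum_(1 <= i < n.+1) indeg n i w.

Definition stat (n : nat) (w : T) : R * R * R :=
  ((A_ n w)%:R / n%:R, (B_ n w)%:R / (s_ n)%:R, (C_ n w)%:R / (s_ n)%:R).

Definition pos_sample (n : nat) (w : T) : nat :=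
  \sum_(i < k n) (X (U n i w) w : nat).

(* sigma-field generated by the states of v_1, ..., v_n and the draws of the
   epochs N, ..., n' - 1. The sigma-field F_n is [info n n]; adjoining the draws
   of epoch n gives [info n n.+1]. *)
Definition info (n n' : nat) : set (set T) :=
  <<s [set E | (exists i b, (1 <= i <= n)%N /\ E = [set w | X i w = b]) \/
               (exists j i m, [/\ (N <= j < n')%N, (i < k j)%N &
                                 E = [set w | U j i w = m]])] >>.

(* Y is a version of the conditional probability of E given the sigma-field F. *)
Definition is_cond_prob (F : set (set T)) (E : set T) (Y : T -> R) : Prop :=
  (forall S : set R, measurable S -> F (Y @^-1` S)) /\
  (forall H, F H -> P (H `&` E) = \int[P]_(w in H) (Y w)%:E)%E.

Definition draw_prob (beta : nat -> R) (n m : nat) (w : T) : R :=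
  ((indeg n m w)%:R + beta n) /
  ((\sum_(1 <= j < n.+1) indeg n j w)%:R + n%:R * beta n).

(* The second clause says that the draws of epoch n are conditionally i.i.d.
   given F_n, through their joint mass function. *)
Definition is_growing_model (beta : nat -> R) (g : R -> R) : Prop :=
  forall n, (N <= n)%N ->
  [/\ forall i w, (i < k n)%N -> (1 <= U n i w <= n)%N,
      forall m : 'I_(k n) -> nat, (forall i, (1 <= m i <= n)%N) ->
        is_cond_prob (info n n) [set w | forall i : 'I_(k n), U n i w = m i]
          (fun w => \prod_(i < k n) draw_prob beta n (m i) w) &
      is_cond_prob (info n n.+1) [set w | X n.+1 w = true]
        (fun w => g ((pos_sample n w)%:R / (k n)%:R))].

End Model.

(* Main.v *)
Require Import Defs.
From HB Require Import structures.
From mathcomp Require Import all_boot all_order all_algebra.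
From mathcomp Require Import all_classical all_reals all_analysis.
From mathcomp Require Import zify ring lra measurable_realfun.

Set Implicit Arguments.
Unset Strict Implicit.
Unset Printing Implicit Defensive.

Import Order.TTheory GRing.Theory Num.Theory.
Import numFieldNormedType.Exports.

Local Open Scope classical_set_scope.
Local Open Scope ring_scope.

(** The inclusion leaves the set where the share [q] equals [qs] and [a = g qs]
    along a linear flow in [(b, c)] that contracts to one equilibrium, namely
    [(g qs, qs g(qs), qs g(qs) + (1 - qs)(1 - g(qs)))].  That this point
    satisfies [q = qs] is the equation [Ghat qs = 0].  The limit set below is this
    single point: it is invariant and internally chain transitive because
    constant maps solve the inclusion there.  What has to be proved is that the
    statistics converge to it almost surely.

    Let [q_j] be the conditional probability that a draw of epoch [j] hits a vertex
    of state [+1], and [r_j] the observed proportion among the [k_j] draws.  Then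
    [A_n / n], [B_n / s_n] and [(C_n - B_n) / s_n] are averages over [j < n] of
    [x_j], [r_j x_j] and [(1 - r_j)(1 - x_j)], where [x_j] is the indicator of
    [X_(j+1) = +1]; the first has weights [1], the others have weights [k_j].

    _Noise._  Replacing [x_j] by [g(r_j)] costs a martingale difference, and
    replacing [r_j] by [q_j] costs at most a multiple of [|r_j - q_j|].  The square of
    [r_j - q_j] is a martingale difference plus a conditional variance at most
    [1 / k_j], which vanishes because the sample sizes grow.  So three families of
    bounded, pairwise orthogonal variables must average to zero
    ([orthogonal_lln]): the second moment of the [n]-th average is of order
    [1 / n], hence summable along the squares, and between squares the average
    moves little.  Both facts need every weight up to time [n] to be at most
    of order [s_n / n] ([kap_bound]); the lower bound [eta1] gives this once [s_n / n] is
    known to be nondecreasing, which is what [eta2 <= 1] says.  All variables known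
    at a given epoch take finitely many values, so conditional expectations are
    finite sums over atoms ([determined_cond_prob]).

    _Mean field._  Up to errors tending to zero, [a], [b] and [b' = c - b] are now
    averages of [g(q_j)], [q_j g(q_j)] and [(1 - q_j)(1 - g(q_j))], while
    [q (b + b' + alpha) = b + alpha a].  For every [t],
    [(q - t)(b + b' + alpha) = (1 - t) b - t b' + alpha (a - t)].
    Take for [t] the limsup of [q_n].  As [g] increases, the right-hand side is
    asymptotically at most its value when every [q_j] is [t], and that value is
    [Ghat t]; so [Ghat t >= 0].  Since [Ghat] is negative to the right of its only
    root, the limsup is at most [qs] ([share_limsup_le]).  Exchanging the two
    states turns this into the bound on the liminf, whence [q_n] tends to [qs] and
    the averages tend to the equilibrium ([mean_field_cvg]). *)

(** * Equilibria of differential inclusions *)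

Section Equilibrium.
Context {R : realType} {V : normedModType R}.
Variables (F : V -> set V) (z : V).
Hypothesis Fz : F z 0.

Lemma cst_solution (D : set R) : is_solution F D (cst z) z.
Proof.
split => //.
  move=> a b _ _ e e0; exists 1 => // s _ _ _.
  by rewrite big1_seq// => I _; rewrite subrr normr0.
apply/aeW => t _; split; first exact: derivable_cst.
by rewrite derive1_cst.
Qed.

Lemma equilibrium_chain_transitive : chain_transitive F [set z].
Proof.
move=> e T u v e0 T0 -> ->.
exists 1%N, (fun=> z), (fun=> cst z), (fun=> T + 1); split => // i _; split => //.
- exact: cst_solution.
- by rewrite ltrDl.
- by rewrite /= subrr normr0.
Qed.

Lemma equilibrium_invariant : invariant_set F [set z].
Proof. by move=> u ->; exists (cst z) => //; exact: cst_solution. Qed.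

End Equilibrium.

Lemma cvg_to_set1 {R : realType} {V : normedModType R} (u : nat -> V) (z : V) :
  u @ \oo --> z -> cvg_to_set u [set z].
Proof.
move=> uz; rewrite /cvg_to_set.
under eq_fun do rewrite image_set1 ereal_inf1.
apply: cvg_EFin; first exact: nearW.
apply: cvg_trans (_ : (fun n => `|u n - z|) @ \oo --> 0).
  by apply: near_eq_cvg; exact: nearW.
by rewrite -(normr0 V); apply: cvg_norm; exact/subr_cvg0.
Qed.


(** * Weighted averages *)

Definition wavg {R : realType} (kappa x : nat -> R) (n : nat) : R :=
  (\sum_(j < n) kappa j * x j) / \sum_(j < n) kappa j.

Section WeightedAverages.
Context {R : realType}.
Variable kappa : nat -> R.
Hypothesis kappa_ge0 : forall j, 0 <= kappa j.
Hypothesis kappa_oo : (fun n => \sum_(j < n) kappa j) @ \oo --> +oo.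

Lemma wavgN x n : wavg kappa (fun j => - x j) n = - wavg kappa x n.
Proof.
rewrite /wavg -mulNr; congr (_ / _); rewrite -sumrN.
by apply: eq_bigr => j _; rewrite mulrN.
Qed.

(** The finitely many terms above [M] contribute a constant to the numerator,
    which the growing denominator absorbs. *)
Lemma wavg_le_near x M e : 0 < e -> (\forall j \near \oo, x j <= M) ->
  \forall n \near \oo, wavg kappa x n <= M + e.
Proof.
move=> e0 [n0 _ hn0].
pose D := \sum_(j < n0) kappa j * `|x j - M|.
have D0 : 0 <= D by apply: sumr_ge0 => j _; rewrite mulr_ge0.
have bnd n : (n0 <= n)%N ->
    \sum_(j < n) kappa j * x j <= M * \sum_(j < n) kappa j + D.
  elim: n => [|n IH].
    by rewrite leqn0 => /eqP n00; rewrite !big_ord0 mulr0 add0r.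
  rewrite leq_eqVlt => /orP[/eqP <-|].
    rewrite /D mulr_sumr -big_split /=; apply: ler_sum => j _.
    rewrite (mulrC M) -mulrDr ler_wpM2l//.
    by rewrite -lerBlDl ler_norm.
  rewrite ltnS => n0n; rewrite !big_ord_recr /=.
  have := IH n0n; have : kappa n * x n <= kappa n * M.
    by rewrite ler_wpM2l// hn0.
  lra.
have /cvgryPge/(_ (D / e + 1)) big := kappa_oo.
near=> n.
have Sb : D / e + 1 <= \sum_(j < n) kappa j by near: n.
have S0 : 0 < \sum_(j < n) kappa j.
  by apply: lt_le_trans Sb; rewrite ltr_wpDl// divr_ge0// ltW.
rewrite /wavg ler_pdivrMr// mulrDl (le_trans (bnd n _))//.
  by near: n; exists n0.
rewrite lerD2l mulrC -ler_pdivrMr//.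
by apply: le_trans Sb; rewrite lerDl.
Unshelve. all: by end_near. Qed.

Lemma wavg_ge_near x M e : 0 < e -> (\forall j \near \oo, M <= x j) ->
  \forall n \near \oo, M - e <= wavg kappa x n.
Proof.
move=> e0 xM; have: \forall j \near \oo, - x j <= - M.
  by apply: filterS xM => j; rewrite lerN2.
move=> /(wavg_le_near e0); apply: filterS => n; rewrite wavgN; lra.
Qed.

Lemma wavg_cvg x (l : R) : x @ \oo --> l -> wavg kappa x @ \oo --> l.
Proof.
move=> /cvgrPdist_le xl; apply/cvgrPdist_le => e e0.
have e20 : 0 < e / 2 by rewrite divr_gt0.
have up : \forall j \near \oo, x j <= l + e / 2.
  by apply: filterS (xl _ e20) => j; rewrite ler_distlC; lra.
have lo : \forall j \near \oo, l - e / 2 <= x j.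
  by apply: filterS (xl _ e20) => j; rewrite ler_distlC; lra.
have := wavg_le_near e20 up; have := wavg_ge_near e20 lo.
apply: filterS2 => n; rewrite ler_distlC; lra.
Qed.

Lemma wavgD x y n :
  wavg kappa (fun j => x j + y j) n = wavg kappa x n + wavg kappa y n.
Proof.
rewrite /wavg -mulrDl; congr (_ / _); rewrite -big_split /=.
by apply: eq_bigr => j _; rewrite mulrDr.
Qed.

Lemma wavgZ a x n : wavg kappa (fun j => a * x j) n = a * wavg kappa x n.
Proof.
rewrite /wavg mulrA; congr (_ / _); rewrite mulr_sumr.
by apply: eq_bigr => j _; rewrite mulrCA.
Qed.

Lemma le_wavg x y n : (forall j, x j <= y j) -> wavg kappa x n <= wavg kappa y n.
Proof.
move=> xy; rewrite /wavg ler_wpM2r ?invr_ge0 ?sumr_ge0//.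
by apply: ler_sum => j _; rewrite ler_wpM2l.
Qed.

Lemma wavg_norm_le x n : `|wavg kappa x n| <= wavg kappa (fun j => `|x j|) n.
Proof.
rewrite ler_norml -wavgN !le_wavg// => j; rewrite ?ler_norm//.
by rewrite lerNl -normrN ler_norm.
Qed.

(** Only the averages of the squares [e j ^+ 2] can be controlled, through
    conditional variances.  They suffice because
    [K |e| <= eps / 4 + K^2 e^2 / eps] for every [eps > 0]. *)
Lemma wavg_sqrt_cvg0 (y e : nat -> R) (K : R) :
  wavg kappa (fun j => e j ^+ 2) @ \oo --> (0 : R) ->
  (\forall j \near \oo, `|y j| <= K * `|e j|) ->
  wavg kappa y @ \oo --> (0 : R).
Proof.
move=> e2 ye; apply/cvgrPdist_le => eps eps0.
pose c := K ^+ 2 / eps.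
have c0 : 0 <= c by rewrite divr_ge0 ?sqr_ge0// ltW.
have small : \forall j \near \oo, `|y j| + - c * e j ^+ 2 <= eps / 4.
  apply: filterS ye => j /le_trans; rewrite -lerBrDr; apply.
  (* the square of [eps / 2 - K |e|], divided by [eps], is what the bound leaves over *)
  have -> : eps / 4 - - c * e j ^+ 2 = K * `|e j| + (eps / 2 - K * `|e j|) ^+ 2 / eps.
    by rewrite -(@real_normK _ (e j)) ?num_real// /c; field; rewrite gt_eqF.
  by rewrite lerDl divr_ge0 ?sqr_ge0// ltW.
have eps40 : 0 < eps / 4 by lra.
have := wavg_le_near eps40 small.
have d0 : 0 < eps / 2 / (c + 1) by rewrite !divr_gt0//; lra.
have /cvgrPdist_le/(_ _ d0) := e2.
apply: filterS2 => n; rewrite !sub0r !normrN ler_pdivlMr; last lra.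
move=> h1; rewrite wavgD wavgZ => h2.
apply: (le_trans (wavg_norm_le y n)).
have := ler_norm (wavg kappa (fun j => e j ^+ 2) n).
move=> /(ler_wpM2l c0).
have := normr_ge0 (wavg kappa (fun j => e j ^+ 2) n).
lra.
Qed.

(** Shape of the three comparisons between a statistic and its mean-field
    average: [zeta] is the martingale noise and [e] the sampling error [r - q]. *)
Lemma wavg_perturb (u v zeta e : nat -> R) (K : R) :
  wavg kappa zeta @ \oo --> (0 : R) ->
  wavg kappa (fun j => e j ^+ 2) @ \oo --> (0 : R) ->
  (\forall j \near \oo, `|u j - v j - zeta j| <= K * `|e j|) ->
  (fun n => wavg kappa u n - wavg kappa v n) @ \oo --> (0 : R).
Proof.
move=> hz e2 huv; have hy := wavg_sqrt_cvg0 e2 huv.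
have -> : (fun n => wavg kappa u n - wavg kappa v n) =
    (fun n => wavg kappa zeta n + wavg kappa (fun j => u j - v j - zeta j) n).
  apply/funext => n; rewrite -wavgD -wavgN -wavgD; congr (wavg _ _ n).
  by apply/funext => j; ring.
by rewrite -[0]addr0; apply: cvgD.
Qed.

End WeightedAverages.

(** * The mean-field equations *)

(** The derivative of the extension is bounded on the compact interval, and the
    mean value theorem applies to the extension. *)
Lemma C1_lipschitz {R : realType} (g : R -> R) : C1_on01 g ->
  exists K : R, forall x y : R, 0 <= x <= 1 -> 0 <= y <= 1 ->
    `|g x - g y| <= K * `|x - y|.
Proof.
move=> [D [gt [oD sub gtg dgt cgt]]].
have cont : {within `[0, 1], continuous (derive1 gt)}.
  apply/subspace_continuousP => x /sub Dx.
  by apply: cvg_trans (cgt x Dx); apply: cvg_app; exact: cvg_within.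
have /compact_bounded[M [_ HM]] := continuous_compact cont (@segment_compact R 0 1).
pose K := M + 1.
have dK c : 0 <= c <= 1 -> `|(derive1 gt) c| <= K.
  move=> c01; apply: (HM K); first by rewrite ltrDl.
  by exists c => //=; rewrite in_itv.
exists K => x y x01 y01.
wlog xy : x y x01 y01 / x <= y.
  move=> h; case: (leP x y) => [|/ltW] xy; first exact: h.
  by rewrite distrC (distrC x); exact: h.
rewrite distrC (distrC x) -!gtg ?in_itv//=.
have inD z : z \in `[x, y] -> D z.
  by rewrite in_itv /= => zxy; apply: sub; rewrite /= in_itv /=; lra.
have der z : z \in `]x, y[ -> is_derive z 1 gt ((derive1 gt) z).
  move=> zxy; have Dz : D z by apply: inD; exact: subset_itv_oo_cc zxy.
  by rewrite derive1E; apply/derivableP; exact: dgt.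
have cgt' : {within `[x, y], continuous gt}.
  apply: derivable_within_continuous => z zxy; apply: dgt; exact: inD.
have [c cxy ->] := MVT_segment xy der cgt'.
rewrite normrM ler_wpM2r// dK//.
by move: cxy; rewrite in_itv /=; lra.
Qed.

Lemma lipschitz01_ge0 {R : realType} (g : R -> R) (K : R) :
  (forall x y : R, 0 <= x <= 1 -> 0 <= y <= 1 -> `|g x - g y| <= K * `|x - y|) ->
  0 <= K.
Proof.
move=> gLip; have /le_trans := normr_ge0 (g 1 - g 0).
move=> /(_ (K * `|1 - 0|)); rewrite subr0 normr1 mulr1; apply.
by rewrite -[leRHS]mulr1 -[in leRHS](normr1 R) -{2}(subr0 1) gLip//; lra.
Qed.

Lemma lipschitz01_within {R : realType} (g : R -> R) (K x : R) :
  (forall x y : R, 0 <= x <= 1 -> 0 <= y <= 1 -> `|g x - g y| <= K * `|x - y|) ->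
  0 <= x <= 1 -> g y @[y --> within `[0, 1] (nbhs x)] --> g x.
Proof.
move=> gLip x01; apply/cvgrPdist_le => e e0.
have K0 := lipschitz01_ge0 gLip.
have d0 : 0 < e / (K + 1) by rewrite divr_gt0//; lra.
rewrite near_withinE; near=> y.
rewrite /= in_itv /= => y01; rewrite (le_trans (gLip _ _ x01 y01))//.
have : `|x - y| <= e / (K + 1).
  by near: y; apply: (@cvgr_dist_le _ _ _ (nbhs x) _ id x) => //; exact: cvg_id.
rewrite ler_pdivlMr; last lra.
have := normr_ge0 (x - y); lra.
Unshelve. all: by end_near. Qed.

(** [Ghat 1 = alpha (g 1 - 1)] is negative, so by the intermediate value
    theorem a nonnegative value to the right of [qs] would produce a second root. *)
Lemma Ghat_sign {R : realType} (g : R -> R) (alpha K qs : R) :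
  0 < alpha -> (forall x : R, 0 <= x <= 1 -> 0 <= g x <= 1) ->
  (forall x y : R, 0 <= x <= 1 -> 0 <= y <= 1 -> `|g x - g y| <= K * `|x - y|) ->
  g 1 < 1 -> 0 <= qs ->
  (forall q : R, 0 <= q <= 1 -> Ghat g alpha q = 0 -> q = qs) ->
  forall x, qs < x <= 1 -> Ghat g alpha x < 0.
Proof.
move=> a0 g01 gLip g1 qs0 uniq x /andP[qsx x1].
rewrite ltNge; apply/negP => Gx.
have G1 : Ghat g alpha 1 < 0.
  rewrite /Ghat subrr mulr0 mul0r add0r pmulr_rlt0// subr_lt0//.
have sub : `[x, 1] `<=` `[0, 1].
  by move=> y /=; rewrite !in_itv /=; lra.
have cont : {within `[x, 1], continuous (Ghat g alpha)}.
  apply: (continuous_subspaceW sub); apply/subspace_continuousP => y /=.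
  rewrite in_itv /= => y01.
  have cy : z @[z --> within `[0, 1] (nbhs y)] --> (y : R).
    by apply: cvg_trans; [exact: cvg_within | exact: cvg_id].
  have cg := lipschitz01_within gLip y01.
  rewrite /Ghat; apply: cvgD.
    apply: cvgM; first by apply: cvgM => //; apply: cvgB => //; exact: cvg_cst.
    by apply: cvgB; [apply: cvgM; [exact: cvg_cst|exact: cg]|exact: cvg_cst].
  by apply: cvgM; [exact: cvg_cst|apply: cvgB].
have [|c] := @IVT _ (Ghat g alpha) x 1 0 x1 cont.
  by rewrite ge_min le_max Gx (ltW G1) orbT.
rewrite in_itv /= => cx Gc.
have : c = qs by apply: uniq => //; lra.
lra.
Qed.

(** The sign of [q - t] is that of [(q - t)(b + b' + alpha)], which equals
    [(1 - t) b - t b' + alpha (a - t)]; the bounds on [a], [b] and [b'] make this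
    at most [- d / 4], and [b + b' + alpha] is at most [1 + alpha]. *)
Lemma share_gap {R : realType} (alpha t q a b b' A B B' s d : R) :
  0 < alpha -> 0 <= t <= 1 -> 0 < d -> 0 <= b -> 0 <= b' -> b + b' <= 1 ->
  q * (b + b' + alpha) = b + alpha * a ->
  b <= B + 2 * s -> B' - 2 * s <= b' -> a <= A + 2 * s ->
  0 <= s -> s * (1 + alpha) = d / 8 ->
  (1 - t) * B - t * B' + alpha * (A - t) <= - d + d / 4 ->
  q <= t - d / (4 * (1 + alpha)).
Proof.
move=> alpha0 /andP[t0 t1] d0 b0 b'0 bb qE v1 v2 v3 s0 sE Psi.
have Lle : (q - t) * (b + b' + alpha) <= - (d / 4).
  rewrite mulrBl qE.
  have -> : b + alpha * a - t * (b + b' + alpha) =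
    (1 - t) * b - t * b' + alpha * (a - t) by ring.
  have u1 : (1 - t) * b <= (1 - t) * (B + 2 * s) by rewrite ler_wpM2l//; lra.
  have u2 : t * (B' - 2 * s) <= t * b' by rewrite ler_wpM2l.
  have u3 : alpha * (a - t) <= alpha * (A + 2 * s - t) by rewrite ler_wpM2l//; lra.
  move: u1 u2 u3 sE Psi d0; clear; lra.
have qt : q < t.
  rewrite ltNge; apply/negP => tq.
  have : 0 <= (q - t) * (b + b' + alpha) by rewrite mulr_ge0//; lra.
  lra.
have gap : (t - q) * (b + b' + alpha) <= (t - q) * (1 + alpha).
  by rewrite ler_wpM2l//; lra.
have -> : d / (4 * (1 + alpha)) = d / 4 / (1 + alpha) by field; lra.
have : d / 4 / (1 + alpha) <= t - q by rewrite ler_pdivrMr; lra.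
lra.
Qed.

Section MeanField.
Context {R : realType}.
Variables (g : R -> R) (alpha K : R) (kappa kappa' : nat -> R).
Hypothesis alpha0 : 0 < alpha.
Hypothesis g01 : forall x : R, 0 <= x <= 1 -> 0 <= g x <= 1.
Hypothesis gmono : forall x y : R, 0 <= x -> x <= y -> y <= 1 -> g x <= g y.
Hypothesis gLip : forall x y : R, 0 <= x <= 1 -> 0 <= y <= 1 ->
  `|g x - g y| <= K * `|x - y|.
Hypothesis kappa_ge0 : forall j, 0 <= kappa j.
Hypothesis kappa_oo : (fun n => \sum_(j < n) kappa j) @ \oo --> +oo.
Hypothesis kappa'_ge0 : forall j, 0 <= kappa' j.
Hypothesis kappa'_oo : (fun n => \sum_(j < n) kappa' j) @ \oo --> +oo.

(** [Psi x] is the limit of [(1 - t) b - t b' + alpha (a - t)] when all shares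
    equal [x].  It increases with [x] and equals [Ghat t] at [x = t]; the bound is
    its Lipschitz estimate there. *)
Lemma Ghat_slope_le t x (Psi := fun x => (1 - t) * (x * g x)
     - t * ((1 - x) * (1 - g x)) + alpha * (g x - t)) :
  0 <= t -> t <= x -> x <= 1 ->
  Psi x <= Ghat g alpha t + (2 + 2 * K + alpha * K) * (x - t).
Proof.
move=> t0 tx x1; have a0 := alpha0.
have gt01 : 0 <= g t <= 1 by apply: g01; lra.
have gx01 : 0 <= g x <= 1 by apply: g01; lra.
have gtx : g t <= g x by apply: gmono.
have : g x - g t <= K * (x - t).
  have := @gLip x t; rewrite ger0_norm ?subr_ge0// [`|x - t|]ger0_norm ?subr_ge0//.
  by apply; lra.
have -> : Ghat g alpha t = Psi t by rewrite /Ghat /Psi; ring.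
rewrite /Psi => hL.
have h1 : (1 - t) * (x * g x) - (1 - t) * (t * g t) <= (1 + K) * (x - t).
  rewrite -mulrBr.
  have : x * g x - t * g t <= (1 + K) * (x - t).
    have -> : x * g x - t * g t = (x - t) * g x + t * (g x - g t) by ring.
    have : (x - t) * g x <= (x - t) by rewrite ler_piMr//; lra.
    have : t * (g x - g t) <= 1 * (g x - g t) by rewrite ler_wpM2r//; lra.
    lra.
  have : 0 <= x * g x - t * g t.
    by rewrite subr_ge0 ler_pM//; lra.
  move=> h0; apply: le_trans; apply: ler_piMl => //; lra.
have h2 : t * ((1 - t) * (1 - g t)) - t * ((1 - x) * (1 - g x)) <= (1 + K) * (x - t).
  rewrite -mulrBr.
  have : (1 - t) * (1 - g t) - (1 - x) * (1 - g x) <= (1 + K) * (x - t).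
    have -> : (1 - t) * (1 - g t) - (1 - x) * (1 - g x) =
      (x - t) * (1 - g t) + (1 - x) * (g x - g t) by ring.
    have : (x - t) * (1 - g t) <= (x - t) by rewrite ler_piMr//; lra.
    have : (1 - x) * (g x - g t) <= 1 * (g x - g t) by rewrite ler_wpM2r//; lra.
    lra.
  have : 0 <= (1 - t) * (1 - g t) - (1 - x) * (1 - g x).
    by rewrite subr_ge0 ler_pM//; lra.
  move=> h0; apply: le_trans; apply: ler_piMl => //; lra.
have : alpha * (g x - t) - alpha * (g t - t) <= alpha * K * (x - t).
  by rewrite -mulrBr -mulrA ler_wpM2l ?(ltW alpha0)//; lra.
lra.
Qed.

Variables (q a b b' : nat -> R) (qs : R).
Hypothesis ha : (fun n => a n - wavg kappa' (g \o q) n) @ \oo --> (0 : R).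
Hypothesis hb : (fun n => b n - wavg kappa (fun j => q j * g (q j)) n)
   @ \oo --> (0 : R).
Hypothesis hb' :
  (fun n => b' n - wavg kappa (fun j => (1 - q j) * (1 - g (q j))) n)
   @ \oo --> (0 : R).
Hypothesis hq : \forall n \near \oo,
  [/\ 0 <= q n <= 1, 0 <= b n, 0 <= b' n, b n + b' n <= 1 &
      q n * (b n + b' n + alpha) = b n + alpha * a n].

(** If the limsup [t] exceeded [qs], then [Ghat t < 0].  Once the shares are
    below [x0], slightly above [t], monotonicity of [g] bounds
    [(q - t)(b + b' + alpha)] by [Psi x0] up to a small error, hence by a negative
    constant.  So the shares are eventually below [t] by a fixed margin, against
    the choice of [t]. *)
Lemma share_limsup_le : (forall x, qs < x <= 1 -> Ghat g alpha x < 0) ->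
  0 <= qs -> forall e, 0 < e -> \forall n \near \oo, q n <= qs + e.
Proof.
move=> Gneg qs0; have a0 := alpha0.
(* The limsup is the infimum of the eventual upper bounds. *)
pose E := [set x | \forall n \near \oo, q n <= x].
have E1 : E 1 by apply: filterS hq => n [/andP[]].
have Elb : lbound E 0.
  move=> x Ex; have [n] := @filter_ex _ \oo _ _ (filterI hq Ex).
  by move=> [[/andP[q0 _] _ _ _ _] /(le_trans q0)].
have Einf : has_inf E by split; [exists 1|exists 0].
set t := inf E.
have t0 : 0 <= t by apply: lb_le_inf; [exists 1|].
have t1 : t <= 1 by apply: ge_inf => //; exists 0.
have t01 : 0 <= t <= 1 by rewrite t0.
suff tqs : t <= qs.
  move=> e e0; have [x Ex xt] := inf_adherent e0 Einf.
  by apply: filterS Ex => n /le_trans; apply; rewrite -/t in xt; lra.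
rewrite leNgt; apply/negP => qst.
pose d := - Ghat g alpha t.
have d0 : 0 < d by rewrite oppr_gt0 Gneg// qst.
have K0 := lipschitz01_ge0 gLip.
pose C := 2 + 2 * K + alpha * K.
have aK : 0 <= alpha * K by rewrite mulr_ge0// ltW.
have C0 : 0 < C by rewrite /C; lra.
have [x0' Ex0' x0't] : exists2 x, E x & x < t + d / (4 * C).
  by apply: inf_adherent => //; rewrite divr_gt0// mulr_gt0.
pose x0 := Num.min x0' 1.
have Ex0 : E x0.
  by rewrite /E /x0 /=; apply: filterS2 Ex0' E1 => n h1 h2; rewrite le_min h1.
have tx0 : t <= x0 by apply: ge_inf => //; exists 0.
have x01 : x0 <= 1 by rewrite ge_min lexx orbT.
have x0t : x0 < t + d / (4 * C) by rewrite gt_min x0't.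
have gx0 : 0 <= g x0 <= 1 by apply: g01; lra.
have PsiM := Ghat_slope_le t0 tx0 x01.
have Cx : C * (x0 - t) <= d / 4.
  have : x0 - t <= d / (4 * C) by lra.
  move=> /(ler_wpM2l (ltW C0)) /le_trans; apply.
  by rewrite le_eqVlt; apply/orP; left; apply/eqP; field; lra.
(* [s] bounds the error of each statistic and the slack of each average; with
   the weights [1 - t], [t] and [alpha] these cost [2 s (1 + alpha) = d / 4]. *)
pose s := d / (8 * (1 + alpha)).
have s0 : 0 < s by rewrite divr_gt0// mulr_gt0//; lra.
have PsiLe : (1 - t) * (x0 * g x0) - t * ((1 - x0) * (1 - g x0)) +
    alpha * (g x0 - t) <= - d + d / 4.
  by apply: (le_trans PsiM); rewrite -/C -[Ghat _ _ _]opprK -/d lerD2l.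
have sE : s * (1 + alpha) = d / 8 by rewrite /s; field; lra.
have qx0 : \forall n \near \oo, 0 <= q n <= x0.
  by apply: filterS2 hq Ex0 => n [/andP[q0 _] _ _ _ _] qx; rewrite q0.
have m1 : \forall n \near \oo, q n * g (q n) <= x0 * g x0.
  apply: filterS qx0 => n /andP[q0 qx]; have := g01 (x := q n).
  by move=> gq; rewrite ler_pM//; [lra|apply: gmono].
have m2 : \forall n \near \oo, (1 - x0) * (1 - g x0) <= (1 - q n) * (1 - g (q n)).
  apply: filterS qx0 => n /andP[q0 qx]; have := gmono q0 qx x01.
  by move=> gq; rewrite ler_pM//; lra.
have m3 : \forall n \near \oo, (g \o q) n <= g x0.
  by apply: filterS qx0 => n /andP[q0 qx]; apply: gmono.
have := wavg_le_near kappa_ge0 kappa_oo s0 m1.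
have := wavg_ge_near kappa_ge0 kappa_oo s0 m2.
have := wavg_le_near kappa'_ge0 kappa'_oo s0 m3.
move: ha hb hb' => /cvgrPdist_le/(_ _ s0) ha1 /cvgrPdist_le/(_ _ s0) hb1
  /cvgrPdist_le/(_ _ s0) hb1' w3 w2 w1.
have : E (t - d / (4 * (1 + alpha))).
  rewrite /E /=; near=> n.
  have [q01 bn0 bn0' bb qE] : [/\ 0 <= q n <= 1, 0 <= b n, 0 <= b' n,
    b n + b' n <= 1 & q n * (b n + b' n + alpha) = b n + alpha * a n].
    by near: n.
  have v1 : b n <= x0 * g x0 + 2 * s.
    have : `|0 - (b n - wavg kappa (fun j => q j * g (q j)) n)| <= s by near: n.
    have : wavg kappa (fun j => q j * g (q j)) n <= x0 * g x0 + s by near: n.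
    rewrite ler_distlC; lra.
  have v2 : (1 - x0) * (1 - g x0) - 2 * s <= b' n.
    have : `|0 - (b' n - wavg kappa (fun j => (1 - q j) * (1 - g (q j))) n)| <= s.
      by near: n.
    have : (1 - x0) * (1 - g x0) - s <=
      wavg kappa (fun j => (1 - q j) * (1 - g (q j))) n by near: n.
    rewrite ler_distlC; lra.
  have v3 : a n <= g x0 + 2 * s.
    have : `|0 - (a n - wavg kappa' (g \o q) n)| <= s by near: n.
    have : wavg kappa' (g \o q) n <= g x0 + s by near: n.
    rewrite ler_distlC; lra.
  exact: (share_gap alpha0 t01 d0 bn0 bn0' bb qE v1 v2 v3 (ltW s0) sE PsiLe).
move=> /(ge_inf (ex_intro _ _ Elb)); rewrite -/t.
have : 0 < d / (4 * (1 + alpha)) by rewrite divr_gt0// mulr_gt0//; lra.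
lra.
Unshelve. all: by end_near. Qed.

End MeanField.

Section MeanFieldLimit.
Context {R : realType}.
Variables (g : R -> R) (alpha K qs : R) (kappa kappa' : nat -> R).
Hypothesis alpha0 : 0 < alpha.
Hypothesis g01 : forall x : R, 0 <= x <= 1 -> 0 <= g x <= 1.
Hypothesis gmono : forall x y : R, 0 <= x -> x <= y -> y <= 1 -> g x <= g y.
Hypothesis gLip : forall x y : R, 0 <= x <= 1 -> 0 <= y <= 1 ->
  `|g x - g y| <= K * `|x - y|.
Hypothesis g0 : 0 < g 0.
Hypothesis g1 : g 1 < 1.
Hypothesis qs01 : 0 <= qs <= 1.
Hypothesis Ghat_uniq : forall q : R, 0 <= q <= 1 -> Ghat g alpha q = 0 -> q = qs.
Hypothesis kappa_ge0 : forall j, 0 <= kappa j.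
Hypothesis kappa_oo : (fun n => \sum_(j < n) kappa j) @ \oo --> +oo.
Hypothesis kappa'_ge0 : forall j, 0 <= kappa' j.
Hypothesis kappa'_oo : (fun n => \sum_(j < n) kappa' j) @ \oo --> +oo.
Variables (q a b b' : nat -> R).
Hypothesis ha : (fun n => a n - wavg kappa' (g \o q) n) @ \oo --> (0 : R).
Hypothesis hb : (fun n => b n - wavg kappa (fun j => q j * g (q j)) n)
   @ \oo --> (0 : R).
Hypothesis hb' :
  (fun n => b' n - wavg kappa (fun j => (1 - q j) * (1 - g (q j))) n)
   @ \oo --> (0 : R).
Hypothesis hq : \forall n \near \oo,
  [/\ 0 <= q n <= 1, 0 <= b n, 0 <= b' n, b n + b' n <= 1 &
      q n * (b n + b' n + alpha) = b n + alpha * a n].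

(** The lower bound is the upper bound for the model with the two states
    exchanged: [q] becomes [1 - q], [g] becomes [1 - g(1 - x)], [b] and [b'] trade
    places, and [Ghat] changes sign and is reflected. *)
Lemma share_cvg : q @ \oo --> qs.
Proof.
have up := share_limsup_le (qs := qs) alpha0 g01 gmono gLip kappa_ge0 kappa_oo kappa'_ge0
  kappa'_oo ha hb hb' hq.
have /andP[qs0 qs1] := qs01.
have Gneg := Ghat_sign alpha0 g01 gLip g1 qs0 Ghat_uniq.
pose rg x := 1 - g (1 - x).
have rg01 x : 0 <= x <= 1 -> 0 <= rg x <= 1.
  by move=> x01; have := g01 (x := 1 - x); rewrite /rg; lra.
have rgmono x y : 0 <= x -> x <= y -> y <= 1 -> rg x <= rg y.
  by move=> *; rewrite lerD2l lerN2 gmono//; lra.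
have rgLip x y : 0 <= x <= 1 -> 0 <= y <= 1 -> `|rg x - rg y| <= K * `|x - y|.
  move=> x01 y01; have := @gLip (1 - y) (1 - x).
  have -> : 1 - y - (1 - x) = x - y by ring.
  have -> : g (1 - y) - g (1 - x) = rg x - rg y by rewrite /rg; ring.
  by apply; lra.
have GrE x : Ghat rg alpha x = - Ghat g alpha (1 - x) by rewrite /Ghat /rg; ring.
have rgneg x : 1 - qs < x <= 1 -> Ghat rg alpha x < 0.
  apply: (Ghat_sign (qs := 1 - qs) alpha0 rg01 rgLip).
  - by rewrite /rg subrr; move: g0; lra.
  - lra.
  - move=> y y01; rewrite GrE => /eqP; rewrite oppr_eq0 => /eqP.
    by move=> /Ghat_uniq => /(_ ltac:(lra)); lra.
have lo := share_limsup_le (g := rg) (q := fun n => 1 - q n)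
  (a := fun n => 1 - a n) (b := b') (b' := b) alpha0 rg01 rgmono rgLip
  kappa_ge0 kappa_oo kappa'_ge0 kappa'_oo _ _ _ _ rgneg.
have {}lo : forall e : R, 0 < e -> \forall n \near \oo, 1 - q n <= 1 - qs + e.
  apply: lo.
  - have : (fun n => - (a n - wavg kappa' (g \o q) n)) @ \oo --> (0 : R).
      by rewrite -oppr0; apply: cvgN ha.
    apply: cvg_trans; apply: near_eq_cvg.
    have /cvgryPgt/(_ 0) := kappa'_oo; apply: filterS => n S0.
    have -> : rg \o (fun n => 1 - q n) = fun j => 1 + -1 * (g \o q) j.
      by apply/funext => j; rewrite /rg /= subKr mulN1r.
    rewrite wavgD wavgZ {2}/wavg.
    rewrite (eq_bigr (fun j : 'I_n => kappa' j)) => [|j _]; last by rewrite mulr1.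
    by rewrite divff ?gt_eqF//; ring.
  - apply: cvg_trans hb'; apply: near_eq_cvg; apply: nearW => n.
    congr (_ - wavg _ _ _); apply/funext => j.
    by rewrite /rg subKr.
  - apply: cvg_trans hb; apply: near_eq_cvg; apply: nearW => n.
    congr (_ - wavg _ _ _); apply/funext => j.
    by rewrite /rg !subKr.
  - apply: filterS hq => n [q01 b0 b'0 bb qE]; split => //; try lra.
  - lra.
apply/cvgrPdist_le => e e0; apply: filterS2 (up Gneg qs0 _ e0) (lo _ e0) => n.
rewrite ler_distlC; lra.
Qed.

Lemma reinf_share_cvg : (g \o q) @ \oo --> g qs.
Proof.
apply/cvgrPdist_le => e e0.
have K0 := lipschitz01_ge0 gLip.
have d0 : 0 < e / (K + 1) by rewrite divr_gt0//; lra.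
have /cvgrPdist_le/(_ _ d0) := share_cvg.
apply: filterS2 hq => n [q01 _ _ _ _].
rewrite ler_pdivlMr; last lra.
have := gLip qs01 q01; have := normr_ge0 (qs - q n) => /=; lra.
Qed.

Let cvg_of_sub (u v : nat -> R) (l : R) :
  (fun n => u n - v n) @ \oo --> (0 : R) -> v @ \oo --> l -> u @ \oo --> l.
Proof.
move=> uv vl; have -> : u = fun n => (u n - v n) + v n.
  by apply/funext => n; rewrite subrK.
by rewrite -[l]add0r; apply: cvgD.
Qed.

Lemma mean_field_cvg :
  [/\ a @ \oo --> g qs, b @ \oo --> qs * g qs &
      b' @ \oo --> (1 - qs) * (1 - g qs)].
Proof.
have cq := share_cvg; have cg := reinf_share_cvg.
split.
- exact: (cvg_of_sub ha (wavg_cvg kappa'_ge0 kappa'_oo cg)).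
- apply: (cvg_of_sub hb); apply: wavg_cvg => //; exact: cvgM.
- apply: (cvg_of_sub hb'); apply: wavg_cvg => //.
  by apply: cvgM; apply: cvgB => //; exact: cvg_cst.
Qed.

End MeanFieldLimit.

(** * A law of large numbers for orthogonal variables *)

Local Notation "'E_[ P ] f" := (Rintegral P [set: _] f) (at level 10, f at level 8).

Section BoundedExpectation.
Context {R : realType} {d : measure_display} {T : measurableType d}.
Variable P : probability T R.

(** Every variable of the model is of this kind, which makes the integral
    linear without further integrability conditions. *)
Definition bounded_rv (f : T -> R) : Prop :=
  measurable_fun [set: T] f /\ exists M, forall w, `|f w| <= M.

Lemma bounded_rv_integrable f : bounded_rv f ->
  P.-integrable [set: T] (EFin \o f).
Proof.
move=> [mf [M fM]]; apply: measurable_bounded_integrable => //.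
  by apply: (le_lt_trans (probability_le1 P measurableT)); rewrite ltry.
by exists M; split; [rewrite num_real | move=> x Mx w _ /=; rewrite (le_trans (fM w))// ltW].
Qed.

Lemma bounded_rv_cst c : bounded_rv (fun=> c).
Proof. by split; [exact: measurable_cst|exists `|c|]. Qed.

Lemma bounded_rv_indic A : measurable A -> bounded_rv (\1_A : T -> R).
Proof.
move=> mA; split; first exact: measurable_indic.
by exists 1 => w; rewrite indicE ger0_norm ?ler0n// lern1 leq_b1.
Qed.

Lemma bounded_rvD f g : bounded_rv f -> bounded_rv g ->
  bounded_rv (fun w => f w + g w).
Proof.
move=> [mf [M fM]] [mg [M' gM]]; split; first exact: measurable_funD.
by exists (M + M') => w; rewrite (le_trans (ler_normD _ _))// lerD.
Qed.

Lemma bounded_rvM f g : bounded_rv f -> bounded_rv g ->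
  bounded_rv (fun w => f w * g w).
Proof.
move=> [mf [M fM]] [mg [M' gM]]; split; first exact: measurable_funM.
by exists (M * M') => w; rewrite normrM ler_pM.
Qed.

Lemma bounded_rv_sum I (s : seq I) (f : I -> T -> R) :
  (forall i, bounded_rv (f i)) -> bounded_rv (fun w => \sum_(i <- s) f i w).
Proof.
move=> bf; elim: s => [|i s IH].
  by under eq_fun do rewrite big_nil; exact: bounded_rv_cst.
by under eq_fun do rewrite big_cons; apply: bounded_rvD.
Qed.

Lemma Rintegral_bounded_sum I (s : seq I) (f : I -> T -> R) :
  (forall i, bounded_rv (f i)) ->
  'E_[P] (fun w => \sum_(i <- s) f i w) = \sum_(i <- s) 'E_[P] (f i).
Proof.
move=> bf; elim: s => [|i s IH].
  under eq_Rintegral do rewrite big_nil.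
  by rewrite Rintegral_cst// mul0r big_nil.
under eq_Rintegral do rewrite big_cons.
rewrite RintegralD//; first by rewrite IH big_cons.
  exact: bounded_rv_integrable.
exact/bounded_rv_integrable/bounded_rv_sum.
Qed.

(** Adding one term to the sum adds a cross term, which vanishes by
    orthogonality, and a square. *)
Lemma orthogonal_second_moment (zeta : nat -> T -> R) (kappa : nat -> R) n :
  (forall j, measurable_fun [set: T] (zeta j)) ->
  (forall j w, `|zeta j w| <= 1) ->
  (forall i j, (i < j)%N -> 'E_[P] (fun w => zeta i w * zeta j w) = 0) ->
  'E_[P] (fun w => (\sum_(j < n) kappa j * zeta j w) ^+ 2)
    <= \sum_(j < n) kappa j ^+ 2.
Proof.
move=> mz z1 orth.
have bz j : bounded_rv (zeta j) by split => //; exists 1.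
have bM m : bounded_rv (fun w => \sum_(j < m) kappa j * zeta j w).
  apply: (@bounded_rv_sum _ _ (fun (j : 'I_m) w => kappa j * zeta j w)) => j.
  by apply: bounded_rvM => //; exact: bounded_rv_cst.
elim: n => [|n IH].
  under eq_Rintegral do rewrite big_ord0 expr0n /=.
  by rewrite Rintegral_cst// mul0r big_ord0.
pose M w := \sum_(j < n) kappa j * zeta j w.
have -> : 'E_[P] (fun w => (\sum_(j < n.+1) kappa j * zeta j w) ^+ 2) =
    'E_[P] (fun w => M w ^+ 2 + (2 * kappa n * (M w * zeta n w) +
       kappa n ^+ 2 * (zeta n w ^+ 2))).
  by apply: eq_Rintegral => w _; rewrite big_ord_recr /= -/(M w); ring.
have bM2 : bounded_rv (fun w => M w ^+ 2) by exact: bounded_rvM (bM n) (bM n).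
have bMz : bounded_rv (fun w => M w * zeta n w) by exact: bounded_rvM (bM n) (bz n).
have bz2 : bounded_rv (fun w => zeta n w ^+ 2) by exact: bounded_rvM (bz n) (bz n).
have bcst c f : bounded_rv f -> bounded_rv (fun w => c * f w).
  by move=> bf; apply: bounded_rvM => //; exact: bounded_rv_cst.
rewrite !RintegralD//; do ?apply: bounded_rv_integrable; auto;
  last by apply: bounded_rvD; auto.
rewrite !RintegralZl//; do ?apply: bounded_rv_integrable; auto.
have -> : 'E_[P] (fun w => M w * zeta n w) = 0.
  have -> : 'E_[P] (fun w => M w * zeta n w) =
      'E_[P] (fun w => \sum_(j < n) kappa j * (zeta j w * zeta n w)).
    by apply: eq_Rintegral => w _; rewrite /M mulr_suml; apply: eq_bigr => j _;
      rewrite mulrA.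
  rewrite (@Rintegral_bounded_sum _ _ (fun (j : 'I_n) w => kappa j * (zeta j w * zeta n w))).
    rewrite big1// => j _; rewrite RintegralZl ?orth ?mulr0//.
    exact: (bounded_rv_integrable (bounded_rvM (bz j) (bz n))).
  by move=> j; apply: bcst; exact: bounded_rvM.
rewrite mulr0 add0r big_ord_recr /= lerD// ler_piMr ?sqr_ge0//.
apply: (@le_trans _ _ ('E_[P] (fun=> 1))).
  apply: le_Rintegral => //; try exact: bounded_rv_integrable.
    exact/bounded_rv_integrable/bounded_rv_cst.
  by move=> w _; rewrite -real_normK ?num_real// expr_le1.
rewrite Rintegral_cst// mul1r.
by rewrite le_eqVlt; apply/orP; left; apply/eqP; exact: (congr1 fine (@probability_setT _ _ _ P)).
Qed.

(** By monotone convergence the sum of the [f m] has finite expectation, so it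
    is finite almost everywhere and its terms tend to zero. *)
Lemma summable_moments_ae_cvg0 (f : nat -> T -> R) (c : nat -> R) :
  (forall m, bounded_rv (f m)) -> (forall m w, 0 <= f m w) ->
  (forall m, 'E_[P] (f m) <= c m) -> cvgn (series c) ->
  {ae P, forall w, f m w @[m --> \oo] --> (0 : R)}.
Proof.
move=> bf f0 fc cc.
have c0 m : 0 <= c m by apply: le_trans (fc m); apply: Rintegral_ge0.
pose S w := (\sum_(0 <= m <oo) (f m w)%:E)%E.
have mfE m : measurable_fun [set: T] (fun w => (f m w)%:E).
  by apply/measurable_EFinP; case: (bf m).
have S0 w : (0 <= S w)%E by apply: nneseries_ge0 => m _ _; rewrite lee_fin.
have intS : P.-integrable [set: T] S.
  apply/integrableP; split.
    by apply: ge0_emeasurable_sum => // k w _ _; rewrite lee_fin.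
  rewrite (eq_integral S); last by move=> w _; rewrite gee0_abs.
  rewrite /S integral_nneseries//; last by move=> m w _; rewrite lee_fin.
  apply: (@le_lt_trans _ _ (\sum_(0 <= m <oo) (c m)%:E)%E).
    apply: lee_nneseries => [m _ _|m _].
      by apply: integral_ge0 => w _; rewrite lee_fin.
    have fin : (\int[P]_x (f m x)%:E)%E \is a fin_num.
      exact: integrable_fin_num (bounded_rv_integrable (bf m)).
    by rewrite -(fineK fin) lee_fin fc.
  rewrite (_ : (\sum_(0 <= m <oo) (c m)%:E)%E = (limn (series c))%:E) ?ltry//.
  rewrite -EFin_lim//; congr (limn _).
  by apply/funext => n /=; rewrite sumEFin.
have := integrable_ae (measurableT) intS.
apply: filterS => w /(_ I) Sfin.
apply: cvg_series_cvg_0.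
apply: nondecreasing_is_cvgn.
  by apply/nondecreasing_seqP => n; rewrite /series /= big_nat_recr//= lerDl.
exists (fine (S w)) => _ [n _ <-].
rewrite -lee_fin fineK// /series /= -sumEFin.
by apply: nneseries_lim_ge => k _ _; rewrite lee_fin.
Qed.


Lemma sqrt_nat n : exists m, (m * m <= n < m.+1 * m.+1)%N.
Proof.
elim: n => [|n [m /andP[h1 h2]]]; first by exists 0%N.
have [h|h] := ltnP n.+1 (m.+1 * m.+1); first by exists m; rewrite h (leq_trans h1).
exists m.+1; rewrite h/=.
by move: h2 h; rewrite !mulSn !mulnS; lia.
Qed.

(** Telescoping: [1 / (m+1)^2 <= 1 / m - 1 / (m+1)]. *)
Lemma is_cvg_series_inv_sq : cvgn (series (fun m => (m.+1%:R * m.+1%:R)^-1 : R)).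
Proof.
apply: nondecreasing_is_cvgn.
  apply/nondecreasing_seqP => n; rewrite /series /= big_nat_recr//= lerDl.
  by rewrite invr_ge0 mulr_ge0.
exists 2 => _ [n _ <-].
apply: (@le_trans _ _ (series (fun m => (m.+1%:R * m.+1%:R)^-1 : R) n.+1)).
  by rewrite /series /= big_nat_recr//= lerDl invr_ge0 mulr_ge0.
apply: (@le_trans _ _ (2 - n.+1%:R^-1)); last by rewrite gerBl invr_ge0.
rewrite /series /=; elim: n => [|n IH]; first by rewrite big_nat1 mulr1 invr1; lra.
rewrite big_nat_recr//= (le_trans (lerD IH (lexx _)))//.
rewrite -[n.+2%:R]natr1; set x := n.+1%:R.
have x0 : 0 < x by rewrite ltr0n.
have -> : 2 - x^-1 = 2 - (x + 1)^-1 - (x * (x + 1))^-1 by field; lra.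
rewrite -addrA gerDl addrC subr_le0 lef_pV2 ?posrE ?mulr_gt0//; nra.
Qed.

(** The bound on [kappa j] makes the second moment of the normalized sum at most
    [C^2 / n], which is summable along [n = m^2].  Between [m^2] and [(m+1)^2]
    there are at most [2 m] further terms, each at most [C / n] after
    normalization, so the intermediate sums follow. *)
Lemma orthogonal_lln (zeta : nat -> T -> R) (kappa S : nat -> R) (C : R) :
  (forall j, measurable_fun [set: T] (zeta j)) ->
  (forall j w, `|zeta j w| <= 1) ->
  (forall i j, (i < j)%N -> 'E_[P] (fun w => zeta i w * zeta j w) = 0) ->
  (forall j, 0 <= kappa j) -> (forall n, 0 <= S n) ->
  (forall m n, (m <= n)%N -> S m <= S n) ->
  (forall j n, (j < n)%N -> n%:R * kappa j <= C * S n) -> 0 <= C ->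
  {ae P, forall w,
    (\sum_(j < n) kappa j * zeta j w) / S n @[n --> \oo] --> (0 : R)}.
Proof.
move=> mz z1 orth k0 S0 Smono kS C0.
pose M n w := \sum_(j < n) kappa j * zeta j w.
have bz j : bounded_rv (zeta j) by split => //; exists 1.
have bM n : bounded_rv (M n).
  apply: (@bounded_rv_sum _ _ (fun (j : 'I_n) w => kappa j * zeta j w)) => j.
  by apply: bounded_rvM => //; exact: bounded_rv_cst.
have subseq : {ae P, forall w,
    (M (m.+1 * m.+1)%N w / S (m.+1 * m.+1)%N) ^+ 2 @[m --> \oo] --> (0 : R)}.
  apply: (@summable_moments_ae_cvg0 _
    (fun m => C ^+ 2 * (m.+1%:R * m.+1%:R)^-1)).
  - move=> m; under eq_fun do rewrite exprMn expr2.
    apply: bounded_rvM; last exact: bounded_rv_cst.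
    exact: bounded_rvM.
  - by move=> m w; rewrite sqr_ge0.
  - move=> m; set n := (m.+1 * m.+1)%N.
    have n0 : (0 : R) < n%:R by rewrite ltr0n.
    under eq_Rintegral do rewrite exprMn.
    rewrite RintegralZr//; last exact: bounded_rv_integrable (bounded_rvM (bM n) (bM n)).
    have [Sn0|Sn0] := eqVneq (S n) 0.
      by rewrite Sn0 invr0 expr0n mulr0 mulr_ge0 ?sqr_ge0// invr_ge0 mulr_ge0.
    have Sn : 0 < S n by rewrite lt_def Sn0 S0.
    rewrite exprVn ler_pdivrMr ?exprn_gt0//.
    apply: (le_trans (orthogonal_second_moment kappa n mz z1 orth)).
    apply: (@le_trans _ _ (\sum_(j < n) (C * S n / n%:R) ^+ 2)).
      apply: ler_sum => j _; rewrite lerXn2r ?nnegrE//.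
        by rewrite divr_ge0// mulr_ge0.
      by rewrite ler_pdivlMr// mulrC kS.
    rewrite sumr_const card_ord -mulr_natl -natrM -/n.
    rewrite le_eqVlt; apply/orP; left; apply/eqP; field.
    by rewrite gt_eqF.
  - apply: is_cvg_seriesZ.
    exact: is_cvg_series_inv_sq.
apply: filterS subseq => w Mw.
apply/cvgrPdist_le => e e0.
have e20 : 0 < e / 2 by lra.
have e2sq : 0 < (e / 2) ^+ 2 by rewrite exprn_gt0.
have /cvgrPdist_le/(_ _ e2sq)[m1 _ hm1] := Mw.
have [m2 hm2] : exists m2 : nat, 2 * C / (e / 2) < m2%:R.
  exists (Num.bound (2 * C / (e / 2))); rewrite archi_boundP//.
  by rewrite divr_ge0 ?mulr_ge0// ltW.
exists ((maxn m1 m2).+1 * (maxn m1 m2).+1)%N => // n /= hn.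
have [[|m] /andP[mn nm]] := sqrt_nat n; first by lia.
have [m1m m2m] : (m1 <= m)%N /\ (m2 <= m)%N.
  have : (maxn m1 m2 < m.+1)%N.
    rewrite ltnS leqNgt; apply/negP => h.
    have := leq_mul h h; rewrite leqNgt; lia.
  by rewrite ltnS geq_max => /andP.
set i := (m.+1 * m.+1)%N in mn.
have i0 : (0 : R) < i%:R by rewrite ltr0n.
have n0 : (0 : R) < n%:R by rewrite ltr0n (leq_trans _ mn).
have Mi : `|M i w| <= e / 2 * S i.
  have [Si0|Si0] := eqVneq (S i) 0.
    rewrite /M big1 ?normr0 ?Si0 ?mulr0// => j _.
    have := kS j i (ltn_ord j); rewrite Si0 mulr0 pmulr_rle0// => kj.
    by rewrite (@le_anti _ _ (kappa j) 0) ?mul0r// kj k0.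
  have Si : 0 < S i by rewrite lt_def Si0 S0.
  have := hm1 m m1m; rewrite /= -/i sub0r normrN ger0_norm ?sqr_ge0//.
  rewrite -(@real_normK _ (M i w / S i)) ?num_real//.
  rewrite ler_pXn2r// ?nnegrE ?normr_ge0 ?(ltW e20)//.
  by rewrite normrM normfV (gtr0_norm Si) ler_pdivrMr.
rewrite sub0r normrN; have [Sn0|Sn0] := eqVneq (S n) 0.
  by rewrite Sn0 invr0 mulr0 normr0 ltW.
have Sn : 0 < S n by rewrite lt_def Sn0 S0.
rewrite normrM normfV (gtr0_norm Sn) ler_pdivrMr// -/(M n w).
have Mni : `|M n w - M i w| <= (n - i)%:R * (C * S n / n%:R).
  rewrite /M -!(big_mkord xpredT (fun j => kappa j * zeta j w)).
  rewrite (big_cat_nat (leq0n i) mn)//= addrAC subrr add0r.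
  apply: (le_trans (ler_norm_sum _ _ _)).
  rewrite mulr_natl -sumr_const_nat !big_nat; apply: ler_sum => j /andP[_ jn].
  rewrite normrM (ger0_norm (k0 j)) ler_pdivlMr//.
  apply: le_trans (kS _ _ jn); rewrite mulrC mulrA -(mulrA _ (kappa j)).
  by rewrite ler_wpM2l// ler_piMr.
have : (n - i)%:R * (C * S n / n%:R) <= e / 2 * S n.
  suff h : (n - i)%:R * C <= e / 2 * n%:R.
    by rewrite !mulrA ler_pdivrMr// -(mulrAC (e / 2)) ler_wpM2r.
  apply: (@le_trans _ _ ((2 * m.+1)%:R * C)).
    by rewrite ler_wpM2r// ler_nat /i; move: nm; clear; lia.
  apply: (@le_trans _ _ (e / 2 * i%:R)); last by rewrite ler_wpM2l ?ler_nat// ltW.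
  rewrite /i !natrM mulrA -mulrA (mulrC m.+1%:R) mulrA ler_wpM2r//.
  move: hm2; rewrite ltr_pdivrMr// => /ltW/le_trans; apply.
  by rewrite mulrC ler_wpM2l ?(ltW e20)// ler_nat leqW.
have := Smono _ _ mn; move=> /(ler_wpM2l (ltW e20)) Sin.
have := ler_normD (M n w - M i w) (M i w); rewrite subrK; lra.
Qed.

End BoundedExpectation.

(** * Conditioning on finite histories *)

Section FiniteHistory.
Context {R : realType} {d : measure_display} {T : measurableType d}.
Variables (P : probability T R) (G : set (set T)).
Variables (I : finType) (V : I -> T -> nat) (b : nat).
Hypothesis Gmeas : forall A, G A -> measurable A.
Hypothesis Vb : forall i w, (V i w <= b)%N.
Hypothesis VG : forall i m, <<s G >> [set w | V i w = m].

(** The values of all observed variables at once: the level sets of [atom] are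
    the atoms of the finite sigma-field that the variables generate. *)
Definition atom (w : T) : {ffun I -> 'I_b.+1} := [ffun i => inord (V i w)].

Lemma sigma_sub_measurable A : <<s G >> A -> measurable A.
Proof.
apply: smallest_sub; first exact: sigma_algebra_measurable.
exact: Gmeas.
Qed.

Lemma atom_sigma s : <<s G >> [set w | atom w = s].
Proof.
have -> : [set w | atom w = s] = \bigcap_(i in [set: I]) [set w | V i w = s i].
  apply/seteqP; split => w /=.
    by move=> <- i _ /=; rewrite ffunE inordK// ltnS.
  move=> h; apply/ffunP => i; rewrite ffunE; apply/val_inj.
  by rewrite /= inordK ?ltnS// h.
by apply: (@fin_bigcap_measurable _ (g_sigma_algebraType G)) => // i _; exact: VG.
Qed.

Definition determined (Z : T -> R) :=
  forall w w', (forall i, V i w = V i w') -> Z w = Z w'.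

Lemma determinedE Z : determined Z -> exists z : {ffun I -> 'I_b.+1} -> R,
  Z = fun w => \sum_s z s * \1_[set w | atom w = s] w.
Proof.
move=> dZ.
pose z s := if pselect (exists w, atom w = s) is left e then Z (projT1 (cid e))
            else 0.
exists z; apply/funext => w.
rewrite (bigD1 (atom w))//= big1 ?addr0.
  rewrite indicE mem_set// mulr1 /z; case: pselect => [e|]; last by case; exists w.
  case: cid => w' /= hw'; apply: dZ => i.
  move: hw' => /ffunP/(_ i); rewrite !ffunE => /(congr1 val) /=.
  by rewrite !inordK ?ltnS.
move=> s sw; rewrite indicE memNset ?mulr0// => /= e.
by rewrite e eqxx in sw.
Qed.

Lemma determined_bounded_rv Z : determined Z -> bounded_rv Z.
Proof.
move=> /determinedE [z ->]; apply: bounded_rv_sum => s.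
apply: bounded_rvM; first exact: bounded_rv_cst.
by apply/bounded_rv_indic/sigma_sub_measurable; exact: atom_sigma.
Qed.

Lemma Rintegral_indicM H (f : T -> R) : measurable H ->
  'E_[P] (fun w => \1_H w * f w) = (\int[P]_(w in H) f w).
Proof.
move=> mH; rewrite [RHS]Rintegral_mkcond; apply: eq_Rintegral => w _.
by rewrite /patch indicE; case: ifP => _; rewrite ?mul1r ?mul0r.
Qed.

(** A variable that depends on finitely many observations is a linear
    combination of indicators of atoms, and on an atom the claim is the defining
    property of the conditional probability. *)
Lemma determined_cond_prob E Y Z : measurable E -> bounded_rv Y ->
  is_cond_prob P <<s G >> E Y -> determined Z ->
  'E_[P] (fun w => Z w * \1_E w) = 'E_[P] (fun w => Z w * Y w).
Proof.
move=> mE bY [_ EY] /determinedE [z ->].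
have bs s : bounded_rv (\1_[set w | atom w = s] : T -> R).
  by apply/bounded_rv_indic/sigma_sub_measurable; exact: atom_sigma.
have expand f : bounded_rv f ->
    'E_[P] (fun w => (\sum_s z s * \1_[set w | atom w = s] w) * f w) =
    \sum_s z s * \int[P]_(w in [set w | atom w = s]) f w.
  move=> bf.
  have bsf s : bounded_rv (fun w => \1_[set w | atom w = s] w * f w).
    exact: bounded_rvM.
  under eq_Rintegral do rewrite mulr_suml.
  rewrite (@Rintegral_bounded_sum _ _ _ _ _ _ (fun s w => z s * \1_[set w | atom w = s] w * f w)).
    apply: eq_bigr => s _.
    under eq_Rintegral do rewrite -mulrA.
    rewrite RintegralZl ?Rintegral_indicM//.
      by apply: sigma_sub_measurable; exact: atom_sigma.
    exact: bounded_rv_integrable.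
  move=> s; apply: bounded_rvM => //; apply: bounded_rvM => //.
  exact: bounded_rv_cst.
rewrite !expand//; last exact: bounded_rv_indic.
apply: eq_bigr => s _; congr (_ * _).
have mH : measurable [set w | atom w = s].
  by apply: sigma_sub_measurable; exact: atom_sigma.
rewrite /Rintegral -(EY _ (atom_sigma s)) integral_indic//.
by rewrite setIC.
Qed.

End FiniteHistory.

(** * Variance of a sample mean *)

(** The left-hand side is the variance of the mean of [k] independent draws
    from [p]: distinct draws are uncorrelated, and each of the [k] remaining
    terms is at most [1]. *)
Lemma sample_mean_variance {R : realType} (n k : nat) (p x : 'I_n -> R) :
  (forall v, 0 <= p v) -> \sum_v p v = 1 -> (forall v, 0 <= x v <= 1) ->
  (0 < k)%N ->
  \sum_(m : {ffun 'I_k -> 'I_n}) (\prod_i p (m i)) *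
     ((\sum_i x (m i)) / k%:R - \sum_v p v * x v) ^+ 2 <= k%:R^-1.
Proof.
move=> p0 p1 x01 k0; set q := \sum_v p v * x v.
have q01 : 0 <= q <= 1.
  apply/andP; split.
    by apply: sumr_ge0 => v _; rewrite mulr_ge0//; case/andP: (x01 v).
  rewrite -p1; apply: ler_sum => v _; apply: ler_piMr => //.
  by case/andP: (x01 v).
have kR0 : (0 : R) < k%:R by rewrite ltr0n.
pose y v := x v - q.
(* the factors of [\prod_i p (m i) * y (m a) * y (m b)], so that summing over [m]
   factorizes *)
pose F (a b i : 'I_k) v :=
  p v * (if i == a then y v else 1) * (if i == b then y v else 1).
have prodF a b (m : {ffun 'I_k -> 'I_n}) :
    \prod_i F a b i (m i) = (\prod_i p (m i)) * (y (m a) * y (m b)).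
  rewrite /F !big_split /= -mulrA -!big_mkcond /= !big_pred1_eq//.
have yE : \sum_v p v * y v = 0.
  under eq_bigr do rewrite mulrBr.
  by rewrite big_split /= sumrN -mulr_suml p1 mul1r subrr.
have cov a b : \sum_(m : {ffun 'I_k -> 'I_n}) (\prod_i p (m i)) * (y (m a) * y (m b))
    <= (a == b)%:R.
  under eq_bigr do rewrite -prodF.
  rewrite -bigA_distr_bigA /=; have [<-|ab] := eqVneq a b.
    rewrite (bigD1 a)//= [X in _ * X]big1 ?mulr1; last first.
      by move=> i ia; rewrite /F (negPf ia); under eq_bigr do rewrite !mulr1.
    rewrite -[leRHS]p1; apply: ler_sum => v _; rewrite /F eqxx -mulrA.
    rewrite ler_piMr// /y; have := x01 v; have := q01 => ? ?.
    by rewrite -expr2 -real_normK ?num_real// expr_le1// ler_norml; lra.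
  rewrite (bigD1 a)//= (_ : \sum_j _ = 0) ?mul0r// -[RHS]yE.
  by apply: eq_bigr => v _; rewrite /F eqxx (negPf ab) mulr1.
have -> : \sum_(m : {ffun 'I_k -> 'I_n}) (\prod_i p (m i)) *
     ((\sum_i x (m i)) / k%:R - q) ^+ 2 =
   (\sum_a \sum_b \sum_(m : {ffun 'I_k -> 'I_n})
     (\prod_i p (m i)) * (y (m a) * y (m b))) / k%:R ^+ 2.
  under [in RHS]eq_bigr do rewrite exchange_big.
  rewrite exchange_big mulr_suml; apply: eq_bigr => m _ /=.
  have -> : (\sum_i x (m i)) / k%:R - q = (\sum_i y (m i)) / k%:R.
    rewrite /y sumrB sumr_const card_ord -[q *+ k]mulr_natr mulrBl.
    by rewrite mulfK ?gt_eqF.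
  rewrite expr_div_n mulrA; congr (_ / _).
  rewrite expr2 mulr_suml mulr_sumr; apply: eq_bigr => a _.
  by rewrite !mulr_sumr.
rewrite ler_pdivrMr ?exprn_gt0// expr2 mulrA mulVf ?gt_eqF// mul1r.
apply: (@le_trans _ _ (\sum_(a < k) \sum_(b < k) (a == b)%:R)).
  by apply: ler_sum => a _; apply: ler_sum => b _.
rewrite (eq_bigr (fun=> 1)) ?sumr_const ?card_ord// => a _.
rewrite (bigD1 a)//= eqxx big1 ?addr0// => i ia.
by rewrite eq_sym (negPf ia).
Qed.

(** * The growing graph *)

Section GrowingModel.
Context {R : realType} {d : measure_display} {T : measurableType d}.
Variables (P : probability T R) (N : nat) (k : nat -> nat).
Variables (X : nat -> {RV P >-> bool}) (U : nat -> nat -> {RV P >-> nat}).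
Variables (beta : nat -> R) (g : R -> R).
Hypothesis hN : (1 <= N)%N.
Hypothesis hk : forall n, (N <= n)%N -> (0 < k n)%N.
Hypothesis hbeta : forall n, (N <= n)%N -> 0 < beta n.
Hypothesis g01 : forall x : R, 0 <= x <= 1 -> 0 <= g x <= 1.
Hypothesis hmodel : is_growing_model N k X U beta g.

Lemma draw_range n i w : (N <= n)%N -> (i < k n)%N -> (1 <= U n i w <= n)%N.
Proof. by move=> /hmodel[h _ _]; exact: h. Qed.

Lemma edgesS n w : (N <= n)%N ->
  edges N k X U n.+1 w = edges N k X U n w ++ new_edges k X U n w.
Proof.
by move=> Nn; rewrite /edges subSn// -addn1 iotaD map_cat flatten_cat/= subnKC//
  cats0.
Qed.

Lemma edges_nil n w : (n <= N)%N -> edges N k X U n w = [::].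
Proof. by rewrite /edges -subn_eq0 => /eqP ->. Qed.

(** This is what allows in-degrees to be summed edge by edge: no edge escapes a
    sum over the vertices [v_1], ..., [v_n]. *)
Lemma edges_target n w e : e \in edges N k X U n w -> (1 <= e.2 <= n)%N.
Proof.
move=> /flattenP[/= s /mapP[j]]; rewrite mem_iota => /andP[Nj jn] -> /mapP[i].
rewrite mem_filter mem_iota => /andP[_ /andP[_ ik]] -> /=.
by have := @draw_range j i w Nj ik; lia.
Qed.

Lemma sum_indeg n w (Q : pred nat) :
  (\sum_(1 <= v < n.+1 | Q v) indeg N k X U n v w)%N =
  count (fun e => Q e.2) (edges N k X U n w).
Proof.
rewrite /indeg.
under eq_bigr => v _ do rewrite -sum1_count big_mkcond /=.
rewrite exchange_big /= -sum1_count [RHS]big_mkcond /= big_seq [RHS]big_seq.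
apply: eq_bigr => e /edges_target ht.
rewrite big_mkcond /= (bigD1_seq e.2) ?iota_uniq ?mem_index_iota//= eqxx.
by rewrite big1 ?addn0// => v /negPf ev; rewrite eq_sym ev if_same.
Qed.

Lemma B_count n w : B_ N k X U n w = count (fun e => X e.2 w) (edges N k X U n w).
Proof. exact: sum_indeg. Qed.

Lemma C_size n w : C_ N k X U n w = size (edges N k X U n w).
Proof. by rewrite /C_ (sum_indeg n w predT) count_predT. Qed.

Definition pos_share n w : R := (pos_sample k X U n w)%:R / (k n)%:R.

Lemma pos_sample_count n w :
  pos_sample k X U n w = count (fun i => X (U n i w) w) (iota 0 (k n)).
Proof.
rewrite /pos_sample -(big_mkord xpredT (fun i => nat_of_bool (X (U n i w) w))).
by rewrite -sum1_count [RHS]big_mkcond /index_iota subn0.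
Qed.

Lemma pos_share01 n w : 0 <= pos_share n w <= 1.
Proof.
have [k0|k0] := posnP (k n); first by rewrite /pos_share k0 invr0 mulr0 lexx ler01.
have kp : (0 : R) < (k n)%:R by rewrite ltr0n.
rewrite /pos_share divr_ge0//= ler_pdivrMr// mul1r ler_nat pos_sample_count.
by rewrite (leq_trans (count_size _ _))// size_iota.
Qed.

(** An edge is added exactly when the states at its two ends agree, so the edges
    that reach a [+1] vertex are all the positive draws if the new vertex is
    [+1], and none otherwise. *)
Lemma B_S n w : (N <= n)%N ->
  (B_ N k X U n.+1 w)%:R = (B_ N k X U n w)%:R +
    (k n)%:R * (pos_share n w * (X n.+1 w)%:R) :> R.
Proof.
move=> Nn; have kp : (k n)%:R != 0 :> R by rewrite pnatr_eq0 -lt0n hk.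
rewrite mulrA /pos_share mulrCA divff// mulr1 -natrM -natrD !B_count.
rewrite edgesS// count_cat; congr ((_ + _)%:R); rewrite pos_sample_count.
rewrite /new_edges count_map count_filter.
case: (X n.+1 w); last first.
  by rewrite muln0 -[RHS](count_pred0 (iota 0 (k n))); apply: eq_count => i /=;
     case: (X _ _).
by rewrite muln1; apply: eq_count => i /=; case: (X _ _).
Qed.

(** The difference counts the edges that point to vertices of state [-1], and
    these are the negative draws whenever the new vertex is [-1]. *)
Lemma CB_S n w : (N <= n)%N ->
  (C_ N k X U n.+1 w)%:R - (B_ N k X U n.+1 w)%:R =
    (C_ N k X U n w)%:R - (B_ N k X U n w)%:R +
    (k n)%:R * ((1 - pos_share n w) * (1 - (X n.+1 w)%:R)) :> R.
Proof.
have CB m : (C_ N k X U m w)%:R - (B_ N k X U m w)%:R =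
    (count (fun e => ~~ X e.2 w) (edges N k X U m w))%:R :> R.
  by rewrite C_size B_count -(count_predC (fun e => X e.2 w)) natrD addrAC subrr
     add0r.
move=> Nn; have kp : (k n)%:R != 0 :> R by rewrite pnatr_eq0 -lt0n hk.
rewrite !CB edgesS// count_cat natrD; congr (_ + _).
have -> : 1 - pos_share n w =
    (count (fun i => ~~ X (U n i w) w) (iota 0 (k n)))%:R / (k n)%:R.
  rewrite /pos_share -[X in X - _](divff kp) -mulrBl; congr (_ / _).
  rewrite pos_sample_count -{1}(size_iota 0 (k n)).
  by rewrite -(count_predC (fun i => X (U n i w) w)) natrD addrAC subrr add0r.
rewrite mulrA mulrCA divff// mulr1 /new_edges count_map count_filter.
case: (X n.+1 w); rewrite ?subrr ?mulr0 ?subr0 ?mulr1.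
  have -> : 0 = (count pred0 (iota 0 (k n)))%:R :> R by rewrite count_pred0.
  by congr (_ %:R); apply: eq_count => i /=; case: (X _ _).
by congr (_ %:R); apply: eq_count => i /=; case: (X _ _).
Qed.

(** Setting the weight to zero before epoch [N] lets all averages start at
    [0], so that the total weight up to [n] is exactly [s_ N k n]. *)
Definition kap (j : nat) : R := if (N <= j)%N then (k j)%:R else 0.

Lemma s_sum n : (s_ N k n)%:R = \sum_(j < n) kap j.
Proof.
elim: n => [|n IH]; first by rewrite /s_ big_geq// big_ord0.
rewrite big_ord_recr /= -IH /kap /s_; case: ifP => Nn.
  by rewrite big_nat_recr/= ?natrD// ltnS.
by rewrite !big_geq ?addr0//; lia.
Qed.

Lemma B_sum n w : (B_ N k X U n w)%:R =
  \sum_(j < n) kap j * (pos_share j w * (X j.+1 w)%:R).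
Proof.
elim: n => [|n IH]; first by rewrite B_count edges_nil// big_ord0.
rewrite big_ord_recr /= -IH /kap; case: ifP => Nn; first exact: B_S.
by rewrite mul0r addr0 !B_count !edges_nil//; lia.
Qed.

Lemma CB_sum n w : (C_ N k X U n w)%:R - (B_ N k X U n w)%:R =
  \sum_(j < n) kap j * ((1 - pos_share j w) * (1 - (X j.+1 w)%:R)) :> R.
Proof.
elim: n => [|n IH].
  by rewrite B_count C_size edges_nil// big_ord0 subrr.
rewrite big_ord_recr /= -IH /kap; case: ifP => Nn; first exact: CB_S.
by rewrite mul0r addr0 !B_count !C_size !edges_nil//; lia.
Qed.

Lemma A_sum n w : (A_ X n w)%:R = \sum_(j < n) (X j.+1 w)%:R :> R.
Proof.
rewrite /A_ natr_sum big_add1 /=.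
by rewrite (big_mkord xpredT (fun j => (X j.+1 w)%:R)).
Qed.

Local Notation draw := (draw_prob N k X U beta).

Definition draw_share n w : R :=
  \sum_(v < n) draw n v.+1 w * (X v.+1 w)%:R.

Lemma draw_den n w : (N <= n)%N -> 0 < (C_ N k X U n w)%:R + n%:R * beta n.
Proof.
move=> Nn; rewrite ltr_wpDl// mulr_gt0 ?hbeta// ltr0n.
exact: leq_trans hN Nn.
Qed.

Lemma draw_ge0 n v w : (N <= n)%N -> 0 <= draw n v w.
Proof.
move=> Nn; rewrite divr_ge0 ?(ltW (draw_den w Nn))// addr_ge0//.
by rewrite ltW// hbeta.
Qed.

Lemma draw_sum1 n w : (N <= n)%N -> \sum_(v < n) draw n v.+1 w = 1.
Proof.
move=> Nn; rewrite /draw_prob -mulr_suml big_split /= sumr_const card_ord.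
rewrite -[beta n *+ n]mulr_natl -natr_sum.
rewrite -(big_mkord xpredT (fun v => indeg N k X U n v.+1 w)) -(big_add1 _ _ 0 n.+1 xpredT (fun v => indeg N k X U n v w)).
by rewrite divff// gt_eqF// draw_den.
Qed.

Lemma draw_share01 n w : (N <= n)%N -> 0 <= draw_share n w <= 1.
Proof.
move=> Nn; apply/andP; split.
  by apply: sumr_ge0 => v _; rewrite mulr_ge0// draw_ge0.
rewrite -(draw_sum1 w Nn); apply: ler_sum => v _.
by rewrite ler_piMr ?draw_ge0// lern1 leq_b1.
Qed.

(** Divided by [s_ N k n], this says that the conditional probability of a
    positive draw is [q_alpha] of the statistics, since [n beta_n = alpha s_n]. *)
Lemma draw_shareE n w : (N <= n)%N ->
  draw_share n w * ((C_ N k X U n w)%:R + n%:R * beta n) =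
  (B_ N k X U n w)%:R + beta n * (A_ X n w)%:R.
Proof.
move=> Nn; rewrite A_sum /draw_share mulr_suml.
have -> : (B_ N k X U n w)%:R =
   \sum_(v < n) (indeg N k X U n v.+1 w)%:R * (X v.+1 w)%:R :> R.
  rewrite /B_ big_mkcond /= big_add1 /= natr_sum.
  rewrite (big_mkord xpredT (fun v => (if X v.+1 w then indeg N k X U n v.+1 w else 0)%:R : R)).
  by apply: eq_bigr => v _; case: (X _ w); rewrite ?mulr1 ?mulr0.
rewrite mulr_sumr -big_split /=; apply: eq_bigr => v _.
rewrite /draw_prob -/(C_ N k X U n w) -mulrA mulrACA mulVf ?mulr1 -?mulrDl//.
  by rewrite gt_eqF// draw_den.
Qed.

Definition same_history n n' w w' : Prop :=
  (forall i, (1 <= i <= n)%N -> X i w = X i w') /\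
  (forall j i, (N <= j < n')%N -> (i < k j)%N -> U j i w = U j i w').

(** Measurability with respect to [info n n'] in the form of dependence on the
    history alone: it is stable under all operations at once, and since histories
    take finitely many values nothing is lost. *)
Definition known n n' (Z : T -> R) : Prop :=
  forall w w', same_history n n' w w' -> Z w = Z w'.

Lemma known_le m m' n n' Z : (m <= n)%N -> (m' <= n')%N ->
  known m m' Z -> known n n' Z.
Proof.
move=> mn mn' kZ w w' [h1 h2]; apply: kZ; split.
  by move=> i /andP[i1 im]; apply: h1; rewrite i1 (leq_trans im).
by move=> j i /andP[Nj jm]; apply: h2; rewrite Nj (leq_trans jm).
Qed.

Lemma same_history_edges n w w' : same_history n n w w' ->
  edges N k X U n w = edges N k X U n w'.
Proof.
move=> [hX hU]; congr flatten; apply/eq_in_map => j; rewrite mem_iota => jn.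
have [Nj jn'] : (N <= j)%N /\ (j < n)%N by lia.
have hUj i : i \in iota 0 (k j) -> U j i w = U j i w'.
  by rewrite mem_iota => ij; apply: hU; lia.
rewrite /new_edges (@eq_in_filter _ _ (fun i => X (U j i w') w' == X j.+1 w')).
  by apply/eq_in_map => i; rewrite mem_filter => /andP[_ /hUj ->].
move=> i ij; rewrite hUj// (hX j.+1) ?jn'// hX//.
by move: ij; rewrite mem_iota => ij; have := @draw_range j i w' Nj; lia.
Qed.

Lemma known_draw n v : known n n (draw n v).
Proof.
move=> w w' h; have e := same_history_edges h.
rewrite /draw_prob -!/(C_ _ _ _ _ _ _) !C_size e.
by congr ((_ %:R + _) / _); rewrite /indeg e.
Qed.

Lemma known_draw_share n : known n n (draw_share n).
Proof.
move=> w w' h; apply: eq_bigr => v _; rewrite (known_draw _ h).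
by rewrite (h.1 v.+1)//= ltn_ord.
Qed.

Lemma known_pos_share n : (N <= n)%N -> known n n.+1 (pos_share n).
Proof.
move=> Nn w w' [hX hU]; congr (_ %:R / _); apply: eq_bigr => i _.
by rewrite hU ?Nn ?ltnSn// hX// draw_range.
Qed.

Lemma known_state n n' i : (1 <= i <= n)%N -> known n n' (fun w => (X i w)%:R).
Proof. by move=> i1 w w' [/(_ i i1) -> _]. Qed.

Let G n n' := [set E | (exists i b, (1 <= i <= n)%N /\ E = [set w | X i w = b]) \/
               (exists j i m, [/\ (N <= j < n')%N, (i < k j)%N &
                                 E = [set w | U j i w = m]])].

Lemma state_measurable i b : measurable [set w | X i w = b].
Proof.
rewrite (_ : mkset _ = X i @^-1` [set b])//.
by rewrite -[X in measurable X]setTI; apply: (measurable_funPT (X i)).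
Qed.

Lemma draw_measurable j i m : measurable [set w | U j i w = m].
Proof.
rewrite (_ : mkset _ = U j i @^-1` [set m])//.
by rewrite -[X in measurable X]setTI; apply: (measurable_funPT (U j i)).
Qed.

Lemma info_gen_measurable n n' A : G n n' A -> measurable A.
Proof.
case=> [[i [b [_ ->]]]|[j [i [m [_ _ ->]]]]].
  exact: state_measurable.
exact: draw_measurable.
Qed.

(** A common bound for the sample sizes before epoch [n'], which makes the index
    set of the draws a finite type. *)
Let draws n' := (\sum_(j < n') k j)%N.

(** The state of [v_0] is outside the history, whence the shift in the first
    case.  The pairs that index no draw carry the constant [0]. *)
Let V n n' (i : 'I_n + 'I_n' * 'I_(draws n')) (w : T) : nat :=
  match i with
  | inl i => X i.+1 w
  | inr (j, p) => if (N <= j)%N && (p < k j)%N then U j p w else 0%N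
  end.

Lemma V_le n n' i w : (@V n n' i w <= n'.+1)%N.
Proof.
case: i => [i|[j p]] /=; first by case: (X _ _).
by case: ifP => // /andP[Nj pk]; have := @draw_range j p w Nj pk; have := ltn_ord j; lia.
Qed.

Lemma V_info n n' i m : info N k X U n n' [set w | @V n n' i w = m].
Proof.
have setT_info : info N k X U n n' setT.
  exact: (@measurableT _ (g_sigma_algebraType (G n n'))).
have set0_info : info N k X U n n' set0.
  exact: (@measurable0 _ (g_sigma_algebraType (G n n'))).
case: i => [i|[j p]] /=.
  have X_info b : info N k X U n n' [set w | X i.+1 w = b].
    apply: sub_sigma_algebra; left; exists i.+1, b; split => //=.
  case: m => [|[|m]].
  - rewrite (_ : mkset _ = [set w | X i.+1 w = false])//.
    by apply/seteqP; split => w /=; case: (X _ _).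
  - rewrite (_ : mkset _ = [set w | X i.+1 w = true])//.
    by apply/seteqP; split => w /=; case: (X _ _).
  - rewrite (_ : mkset _ = set0)//.
    by apply/seteqP; split => w /=; case: (X _ _).
have [/andP[Nj pk]|_] := boolP ((N <= j)%N && (p < k j)%N).
  apply: sub_sigma_algebra; right; exists j, p, m; split => //.
  by rewrite Nj ltn_ord.
have [->|m0] := eqVneq m 0%N.
  by suff -> : [set _ | 0%N = 0%N] = setT :> set T by []; apply/seteqP; split.
suff -> : [set _ | 0%N = m] = set0 :> set T by [].
apply/seteqP; split => w //= e.
by rewrite -e eqxx in m0.
Qed.

Lemma known_determined n n' Z : known n n' Z -> determined (@V n n') Z.
Proof.
move=> kZ w w' hV; apply: kZ; split.
  case=> // i /andP[_ ilt]; have /= := hV (inl (Ordinal ilt)).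
  by case: (X _ _); case: (X _ _).
move=> j i /andP[Nj jn] ik.
have iK : (i < draws n')%N.
  apply: (leq_trans ik); rewrite /draws (bigD1 (Ordinal jn))//=; exact: leq_addr.
by have /= := hV (inr (Ordinal jn, Ordinal iK)); rewrite Nj ik.
Qed.

Lemma known_bounded_rv n n' Z : known n n' Z -> bounded_rv Z.
Proof.
move=> /known_determined.
apply: (determined_bounded_rv (@info_gen_measurable n n') (@V_le n n') (@V_info n n')).
Qed.

Lemma known_cond_prob n n' E Y Z : measurable E -> bounded_rv Y ->
  is_cond_prob P (info N k X U n n') E Y -> known n n' Z ->
  'E_[P] (fun w => Z w * \1_E w) = 'E_[P] (fun w => Z w * Y w).
Proof.
move=> mE bY EY /known_determined.
exact: (determined_cond_prob (@info_gen_measurable n n') (@V_le n n') (@V_info n n')).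
Qed.

Lemma exp_state n Z : (N <= n)%N -> known n n.+1 Z ->
  'E_[P] (fun w => Z w * (X n.+1 w)%:R) =
  'E_[P] (fun w => Z w * g (pos_share n w)).
Proof.
move=> Nn kZ; have [_ _ cX] := hmodel Nn.
rewrite -(known_cond_prob _ _ cX kZ); last first.
- apply: (@known_bounded_rv n n.+1) => w w' h.
  by congr g; exact: (known_pos_share Nn h).
- exact: state_measurable.
apply: eq_Rintegral => w _; congr (_ * _).
rewrite indicE; case E: (X n.+1 w); first by rewrite mem_set.
by rewrite memNset//= E.
Qed.

(** The conditional variance of [pos_share n] given the history up to epoch [n],
    written as a sum over all possible samples. *)
Definition sampling_var n w : R :=
  \sum_(m : {ffun 'I_(k n) -> 'I_n}) (\prod_i draw n (m i).+1 w) *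
    ((\sum_i (X (m i).+1 w)%:R) / (k n)%:R - draw_share n w) ^+ 2.

Lemma sampling_var_le n w : (N <= n)%N -> 0 <= sampling_var n w <= (k n)%:R^-1.
Proof.
move=> Nn; apply/andP; split.
  apply: sumr_ge0 => m _; rewrite mulr_ge0 ?sqr_ge0// prodr_ge0// => i _.
  exact: draw_ge0.
apply: (@sample_mean_variance R n (k n) (fun v => draw n v.+1 w)
  (fun v => (X v.+1 w)%:R)).
- by move=> v; exact: draw_ge0.
- exact: draw_sum1.
- by move=> v; rewrite ler0n lern1 leq_b1.
- exact: hk.
Qed.

Lemma known_sampling_var n : known n n (sampling_var n).
Proof.
move=> w w' h; apply: eq_bigr => m _; congr (_ * (_ - _) ^+ 2).
- by apply: eq_bigr => i _; rewrite (known_draw _ h).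
- congr (_ / _); apply: eq_bigr => i _; rewrite (h.1 (m i).+1)//=.
- exact: known_draw_share.
Qed.

Definition sq_dev n w : R := (pos_share n w - draw_share n w) ^+ 2.

(** Expanding [sq_dev] over the possible samples reduces the claim to the joint
    conditional law of the draws. *)
Lemma exp_sq_dev n Z : (N <= n)%N -> known n n Z ->
  'E_[P] (fun w => Z w * sq_dev n w) = 'E_[P] (fun w => Z w * sampling_var n w).
Proof.
move=> Nn kZ; have [_ cU _] := hmodel Nn.
pose E (m : {ffun 'I_(k n) -> 'I_n}) := [set w | forall i : 'I_(k n), U n i w = (m i).+1].
pose D (m : {ffun 'I_(k n) -> 'I_n}) w : R :=
  ((\sum_i (X (m i).+1 w)%:R) / (k n)%:R - draw_share n w) ^+ 2.
have kD m : known n n (D m).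
  move=> w w' h; congr ((_ - _) ^+ 2); last exact: known_draw_share.
  congr (_ / _); apply: eq_bigr => i _; rewrite (h.1 (m i).+1)//=.
have mE m : measurable (E m).
  rewrite (_ : E m = \bigcap_(i in [set: 'I_(k n)]) [set w | U n i w = (m i).+1]).
    by apply: fin_bigcap_measurable => // i _; exact: draw_measurable.
  by apply/seteqP; split => w /= h i; [move=> _; exact: h | exact: (h i I)].
have dec w : sq_dev n w = \sum_m D m w * \1_(E m) w.
  have lt i : ((U n (nat_of_ord (i : 'I_(k n))) w).-1 < n)%N.
    by have := @draw_range n i w Nn (ltn_ord i); lia.
  (* only the sample actually drawn contributes to the sum *)
  pose m0 := [ffun i => Ordinal (lt i)].
  have m0E i : (m0 i).+1 = U n i w.
    by rewrite ffunE /= prednK//; case/andP: (@draw_range n i w Nn (ltn_ord i)).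
  rewrite (bigD1 m0)//= big1 ?addr0.
    rewrite indicE mem_set ?mulr1/=; last by move=> i; rewrite m0E.
    rewrite /sq_dev /D; congr ((_ / _ - _) ^+ 2); rewrite natr_sum.
    by apply: eq_bigr => i _; rewrite m0E.
  move=> m mm0; rewrite indicE memNset ?mulr0// => /= h.
  by move/eqP: mm0; apply; apply/ffunP => i; apply/val_inj/succn_inj; rewrite m0E h.
have kZD m : known n n (fun w => Z w * D m w).
  by move=> w w' h; rewrite (kZ _ _ h) (kD _ _ _ h).
pose Y (m : {ffun 'I_(k n) -> 'I_n}) w := \prod_i draw n (m i).+1 w.
have bY m : bounded_rv (Y m).
  apply: (@known_bounded_rv n n) => w w' h.
  by apply: eq_bigr => i _; rewrite (known_draw _ h).
have bE m : bounded_rv (\1_(E m) : T -> R) by exact: bounded_rv_indic.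
have -> : 'E_[P] (fun w => Z w * sq_dev n w) =
    'E_[P] (fun w => \sum_m (Z w * D m w) * \1_(E m) w).
  apply: eq_Rintegral => w _; rewrite dec mulr_sumr.
  by apply: eq_bigr => m _; rewrite mulrA.
have -> : 'E_[P] (fun w => Z w * sampling_var n w) =
    'E_[P] (fun w => \sum_m (Z w * D m w) * Y m w).
  apply: eq_Rintegral => w _; rewrite mulr_sumr.
  by apply: eq_bigr => m _; rewrite mulrAC -mulrA.
rewrite (@Rintegral_bounded_sum _ _ _ _ _ _ (fun m w => (Z w * D m w) * \1_(E m) w)); last first.
  by move=> m; apply: bounded_rvM => //; exact: known_bounded_rv (kZD m).
rewrite (@Rintegral_bounded_sum _ _ _ _ _ _ (fun m w => (Z w * D m w) * Y m w)); last first.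
  by move=> m; apply: bounded_rvM => //; exact: known_bounded_rv (kZD m).
apply: eq_bigr => m _; apply: (@known_cond_prob n n) => //.
by apply: (cU (fun i => (m i).+1)) => i /=.
Qed.

Definition noise_state n w : R :=
  if (N <= n)%N then (X n.+1 w)%:R - g (pos_share n w) else 0.

Definition noise_pos n w : R := pos_share n w * noise_state n w.

Definition noise_sampling n w : R :=
  if (N <= n)%N then sq_dev n w - sampling_var n w else 0.

Lemma known_noise_state n : known n.+1 n.+1 (noise_state n).
Proof.
move=> w w' h; rewrite /noise_state; case: ifP => // Nn.
rewrite (h.1 n.+1) ?leqnn//; congr (_ - _); congr g.
exact: (@known_le n n.+1 n.+1 n.+1 _ (leqnSn n) (leqnn _) (known_pos_share Nn)).
Qed.

Lemma known_noise_pos n : known n.+1 n.+1 (noise_pos n).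
Proof.
move=> w w' h; rewrite /noise_pos (known_noise_state h) /noise_state.
case: ifP => [Nn|_]; last by rewrite !mulr0.
congr (_ * _).
exact: (@known_le n n.+1 n.+1 n.+1 _ (leqnSn n) (leqnn _) (known_pos_share Nn)).
Qed.

Lemma known_noise_sampling n : known n.+1 n.+1 (noise_sampling n).
Proof.
move=> w w' h; rewrite /noise_sampling; case: ifP => // Nn.
have le (Z : T -> R) : known n n Z -> known n.+1 n.+1 Z.
  exact: known_le.
congr ((_ - _) ^+ 2 - _).
- exact: (@known_le n n.+1 n.+1 n.+1 _ (leqnSn n) (leqnn _) (known_pos_share Nn)).
- exact: (le _ (@known_draw_share n)).
- exact: (le _ (@known_sampling_var n)).
Qed.

Lemma noise_state_orthogonal n Z : known n n.+1 Z ->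
  'E_[P] (fun w => Z w * noise_state n w) = 0.
Proof.
move=> kZ; rewrite /noise_state; have [Nn|_] := boolP (N <= n)%N; last first.
  by under eq_Rintegral do rewrite mulr0; rewrite Rintegral_cst// mul0r.
under eq_Rintegral do rewrite mulrBr.
have bZ := known_bounded_rv kZ.
have bX : bounded_rv (fun w => (X n.+1 w)%:R : R).
  by apply: (@known_bounded_rv n.+1 n.+1); apply: known_state; rewrite /= ltnS.
have bg : bounded_rv (fun w => g (pos_share n w)).
  apply: (@known_bounded_rv n n.+1) => w w' h.
  by congr g; exact: (known_pos_share Nn h).
rewrite RintegralB ?exp_state ?subrr//; apply: bounded_rv_integrable.
  exact: (bounded_rvM bZ bX).
exact: (bounded_rvM bZ bg).
Qed.

Lemma noise_pos_orthogonal n Z : known n n.+1 Z ->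
  'E_[P] (fun w => Z w * noise_pos n w) = 0.
Proof.
move=> kZ; have [Nn|Nn] := boolP (N <= n)%N; last first.
  rewrite /noise_pos /noise_state (negPf Nn).
  by under eq_Rintegral do rewrite !mulr0; rewrite Rintegral_cst// mul0r.
rewrite /noise_pos; under eq_Rintegral do rewrite mulrA.
apply: (noise_state_orthogonal (Z := fun w => Z w * pos_share n w)) => w w' h.
by rewrite /= (kZ _ _ h); congr (_ * _); exact: (known_pos_share Nn h).
Qed.

Lemma noise_sampling_orthogonal n Z : known n n Z ->
  'E_[P] (fun w => Z w * noise_sampling n w) = 0.
Proof.
move=> kZ; rewrite /noise_sampling; have [Nn|_] := boolP (N <= n)%N; last first.
  by under eq_Rintegral do rewrite mulr0; rewrite Rintegral_cst// mul0r.
under eq_Rintegral do rewrite mulrBr.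
have bZ := known_bounded_rv kZ.
have bs : bounded_rv (sampling_var n).
  exact: (known_bounded_rv (@known_sampling_var n)).
have bd : bounded_rv (sq_dev n).
  apply: (@known_bounded_rv n n.+1) => w w' h; congr ((_ - _) ^+ 2).
    exact: (known_pos_share Nn h).
  exact: (@known_le n n n n.+1 _ (leqnn n) (leqnSn n) (@known_draw_share n)).
rewrite RintegralB ?exp_sq_dev ?subrr//; apply: bounded_rv_integrable.
  exact: (bounded_rvM bZ bd).
exact: (bounded_rvM bZ bs).
Qed.

Lemma noise_state_le1 n w : `|noise_state n w| <= 1.
Proof.
rewrite /noise_state; case: ifP => _; last by rewrite normr0.
have := g01 (pos_share01 n w); case: (X _ _) => /=; rewrite ler_norml; lra.
Qed.

Lemma noise_pos_le1 n w : `|noise_pos n w| <= 1.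
Proof.
rewrite /noise_pos normrM mulr_ile1// ?noise_state_le1//.
by have := pos_share01 n w; rewrite ler_norml; lra.
Qed.

Lemma noise_sampling_le1 n w : `|noise_sampling n w| <= 1.
Proof.
rewrite /noise_sampling; case: ifP => [Nn|_]; last by rewrite normr0.
have := sampling_var_le w Nn; have k1 : (k n)%:R^-1 <= 1 :> R.
  by rewrite invf_le1 ?ltr0n ?hk// ler1n hk.
have : 0 <= sq_dev n w <= 1.
  rewrite /sq_dev sqr_ge0 /= -real_normK ?num_real// expr_le1// ler_norml.
  by have := pos_share01 n w; have := draw_share01 w Nn; lra.
rewrite ler_norml; lra.
Qed.

Variables (eta : R).
Hypothesis eta0 : 0 < eta.
Hypothesis eta_lb : forall n, (N <= n)%N ->
  eta * (n.+1%:R * (k n)%:R) <= (s_ N k n.+1)%:R.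
Hypothesis eta_ub : forall n, (N <= n)%N ->
  (s_ N k n.+1)%:R <= n.+1%:R * (k n)%:R :> R.

Lemma kap_ge0 j : 0 <= kap j.
Proof. by rewrite /kap; case: ifP. Qed.

Lemma s_S n : (N <= n)%N -> (s_ N k n.+1)%:R = (s_ N k n)%:R + (k n)%:R :> R.
Proof. by move=> Nn; rewrite !s_sum big_ord_recr /= /kap Nn. Qed.

(** The ratio [s_n / n] is nondecreasing: the upper bound on [s_(n+1)] amounts
    to [s_n <= n k_n], so that the increment [k_n] is at least the mean increment. *)
Lemma s_ratio_mono j n : (N <= j)%N -> (j < n)%N ->
  n%:R * (s_ N k j.+1)%:R <= j.+1%:R * (s_ N k n)%:R :> R.
Proof.
move=> Nj; elim: n => // n IH; rewrite ltnS leq_eqVlt => /orP[/eqP->//|jn].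
have Nn : (N <= n)%N by lia.
have n0 : (0 : R) < n%:R by rewrite ltr0n; lia.
have ub := eta_ub Nn; have sS := s_S Nn; have ih := IH jn.
rewrite -[n.+1%:R]natr1 in ub *.
have sn : (s_ N k n)%:R <= n%:R * (k n)%:R :> R by lra.
have h : (s_ N k j.+1)%:R <= j.+1%:R * (k n)%:R :> R.
  rewrite -(ler_pM2l n0) (le_trans ih)// mulrCA ler_wpM2l//.
rewrite mulrDl mul1r sS mulrDr; lra.
Qed.

(** By the lower bound, [k_j] is at most [s_(j+1) / (eta (j+1))], and monotonicity
    of [s_n / n] replaces [j + 1] by [n]. *)
Lemma kap_bound j n : (j < n)%N -> n%:R * kap j <= eta^-1 * (s_ N k n)%:R.
Proof.
move=> jn; rewrite /kap; case: ifP => [Nj|_]; last first.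
  by rewrite mulr0 mulr_ge0// invr_ge0 ltW.
rewrite ler_pdivlMl//.
have j0 : (0 : R) < j.+1%:R by rewrite ltr0n.
rewrite -(ler_pM2l j0); apply: le_trans (s_ratio_mono Nj jn).
have := ler_wpM2l (ler0n R n) (eta_lb Nj); lra.
Qed.

Lemma kap_oo : (fun n => \sum_(j < n) kap j) @ \oo --> +oo.
Proof.
have lb n : (n%:R - N%:R : R) <= \sum_(j < n) kap j.
  elim: n => [|n IH]; first by rewrite big_ord0 sub0r oppr_le0.
  rewrite big_ord_recr /= /kap; case: ifP => Nn.
    have : (1 : R) <= (k n)%:R by rewrite ler1n hk.
    rewrite -natr1; move: IH; rewrite /kap; lra.
  have : n.+1%:R - N%:R <= 0 :> R by rewrite subr_le0 ler_nat; lia.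
  move=> /le_trans; apply; rewrite addr0; apply: sumr_ge0 => j _.
  exact: kap_ge0.
apply/cvgryPge => A.
have /cvgryPge/(_ (A + N%:R)) := @cvgr_idn R.
by apply: filterS => n h; apply: le_trans (lb n); rewrite lerBrDr.
Qed.

Lemma one_oo : (fun n => \sum_(j < n) (1 : R)) @ \oo --> +oo.
Proof.
by under eq_fun do rewrite sumr_const card_ord; exact: cvgr_idn.
Qed.

(** Orthogonality is the martingale property: an earlier noise is part of the
    history on which a later one is conditioned. *)
Lemma noise_lln (zeta : nat -> T -> R) :
  (forall n, known n.+1 n.+1 (zeta n)) -> (forall n w, `|zeta n w| <= 1) ->
  (forall n Z, known n n Z -> 'E_[P] (fun w => Z w * zeta n w) = 0) ->
  {ae P, forall w, wavg kap (zeta^~ w) @ \oo --> (0 : R) /\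
                   wavg (fun=> 1) (zeta^~ w) @ \oo --> (0 : R)}.
Proof.
move=> kz z1 oz.
have mz j : measurable_fun [set: T] (zeta j) by case: (known_bounded_rv (kz j)).
have orth i j : (i < j)%N -> 'E_[P] (fun w => zeta i w * zeta j w) = 0.
  by move=> ij; apply: oz; exact: (known_le ij ij (kz i)).
have ei0 : 0 <= eta^-1 by rewrite invr_ge0 ltW.
have smono m n : (m <= n)%N -> (s_ N k m)%:R <= (s_ N k n)%:R :> R.
  move=> mn; rewrite !s_sum -!(big_mkord xpredT kap) (big_cat_nat (leq0n m) mn)/=.
  by rewrite lerDl; apply: sumr_ge0 => j _; exact: kap_ge0.
have := orthogonal_lln (kappa := kap) (S := fun n => (s_ N k n)%:R) mz z1 orth
  kap_ge0 (fun n => ler0n _ _) smono kap_bound ei0.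
have := orthogonal_lln (kappa := fun=> 1) (S := fun n => n%:R) (C := 1) mz z1 orth
  (fun=> ler01) (fun n => ler0n _ _).
have mono1 m n : (m <= n)%N -> m%:R <= n%:R :> R by rewrite ler_nat.
have b1 (j n : nat) : (j < n)%N -> n%:R * 1 <= 1 * n%:R :> R.
  by rewrite mulr1 mul1r.
move=> /(_ mono1 b1 ler01).
apply: filterS2 => w h1 hk'; split.
  by apply: cvg_trans hk'; apply: near_eq_cvg; apply: nearW => n; rewrite /wavg s_sum.
apply: cvg_trans h1; apply: near_eq_cvg; apply: nearW => n.
by rewrite /wavg sumr_const card_ord.
Qed.

Variables (alpha K qs : R).
Hypothesis alpha0 : 0 < alpha.
Hypothesis kinf : k n @[n --> \oo] --> \oo.
Hypothesis beta_s : forall n, (N < n)%N -> n%:R * beta n = alpha * (s_ N k n)%:R.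
Hypothesis gmono : forall x y : R, 0 <= x -> x <= y -> y <= 1 -> g x <= g y.
Hypothesis gLip : forall x y : R, 0 <= x <= 1 -> 0 <= y <= 1 ->
  `|g x - g y| <= K * `|x - y|.
Hypothesis g0 : 0 < g 0.
Hypothesis g1 : g 1 < 1.
Hypothesis qs01 : 0 <= qs <= 1.
Hypothesis Ghat_uniq : forall q : R, 0 <= q <= 1 -> Ghat g alpha q = 0 -> q = qs.

Lemma sampling_var_cvg0 w : sampling_var ^~ w @ \oo --> (0 : R).
Proof.
have kinv : (fun n => (k n)%:R^-1 : R) @ \oo --> (0 : R).
  apply/gtr0_cvgV0.
    by exists N => // n /= Nn; rewrite ltr0n hk.
  apply: cvg_comp kinf _; exact: cvgr_idn.
have l0 : (fun=> 0 : R) @ \oo --> (0 : R) by exact: cvg_cst.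
apply: (squeeze_cvgr _ l0 kinv).
by exists N => // n /= Nn; exact: sampling_var_le.
Qed.

Lemma sq_dev_avg_cvg0 (kappa : nat -> R) w :
  (forall j, 0 <= kappa j) -> (fun n => \sum_(j < n) kappa j) @ \oo --> +oo ->
  wavg kappa (noise_sampling^~ w) @ \oo --> (0 : R) ->
  wavg kappa (fun j => (pos_share j w - draw_share j w) ^+ 2) @ \oo --> (0 : R).
Proof.
move=> kappa0 kappaoo hz.
have rest : (fun j => sq_dev j w - noise_sampling j w) @ \oo --> (0 : R).
  apply: cvg_trans (@sampling_var_cvg0 w); apply: near_eq_cvg.
  by exists N => // n /= Nn; rewrite /noise_sampling Nn; ring.
have -> : wavg kappa (fun j => (pos_share j w - draw_share j w) ^+ 2) =
    fun n => wavg kappa (noise_sampling^~ w) n +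
             wavg kappa (fun j => sq_dev j w - noise_sampling j w) n.
  apply/funext => n; rewrite -wavgD; congr (wavg _ _ n).
  by apply/funext => j; rewrite /sq_dev; ring.
by rewrite -[0]addr0; apply: cvgD => //; exact: wavg_cvg.
Qed.

(** The three statistics are averages of [x], [r x] and [(1 - r)(1 - x)].  The
    last one is handled through
    [(1 - r)(1 - x) = (1 - r)(1 - g r) + r (x - g r) - (x - g r)], so that it needs
    no noise of its own. *)
Lemma stat_cvg_pathwise w :
  wavg kap (noise_state^~ w) @ \oo --> (0 : R) ->
  wavg (fun=> 1) (noise_state^~ w) @ \oo --> (0 : R) ->
  wavg kap (noise_pos^~ w) @ \oo --> (0 : R) ->
  wavg kap (noise_sampling^~ w) @ \oo --> (0 : R) ->
  wavg (fun=> 1) (noise_sampling^~ w) @ \oo --> (0 : R) ->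
  [/\ (A_ X n w)%:R / n%:R @[n --> \oo] --> g qs,
      (B_ N k X U n w)%:R / (s_ N k n)%:R @[n --> \oo] --> qs * g qs &
      (C_ N k X U n w)%:R / (s_ N k n)%:R @[n --> \oo] -->
        qs * g qs + (1 - qs) * (1 - g qs)].
Proof.
move=> ns_k ns_1 np_k nv_k nv_1.
have dev_k := sq_dev_avg_cvg0 kap_ge0 kap_oo nv_k.
have dev_1 := sq_dev_avg_cvg0 (fun=> ler01) one_oo nv_1.
pose r j := pos_share j w; pose q j := draw_share j w; pose x j : R := (X j.+1 w)%:R.
have r01 j : 0 <= r j <= 1 by exact: pos_share01.
have q01 j : (N <= j)%N -> 0 <= q j <= 1 by exact: draw_share01.
have g01' y : 0 <= y <= 1 -> 0 <= g y <= 1 := @g01 y.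
pose a n : R := (A_ X n w)%:R / n%:R.
pose b n : R := (B_ N k X U n w)%:R / (s_ N k n)%:R.
pose c n : R := (C_ N k X U n w)%:R / (s_ N k n)%:R.
have aE n : a n = wavg (fun=> 1) x n.
  rewrite /a /wavg A_sum sumr_const card_ord; congr (_ / _).
  by apply: eq_bigr => j _; rewrite mul1r.
have bE n : b n = wavg kap (fun j => r j * x j) n by rewrite /b B_sum s_sum.
have cbE n : c n - b n = wavg kap (fun j => (1 - r j) * (1 - x j)) n.
  by rewrite /c /b -mulrBl CB_sum s_sum.
have ha : (fun n => a n - wavg (fun=> 1) (g \o q) n) @ \oo --> (0 : R).
  under eq_fun do rewrite aE.
  apply: (wavg_perturb (fun=> ler01) one_oo (K := K) ns_1 dev_1).
  exists N => // j /= Nj; rewrite /noise_state Nj -/(r j) -/(x j) -/(q j).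
  have -> : x j - g (q j) - (x j - g (r j)) = g (r j) - g (q j) by ring.
  by apply: gLip => //; exact: q01.
have hb : (fun n => b n - wavg kap (fun j => q j * g (q j)) n) @ \oo --> (0 : R).
  under eq_fun do rewrite bE.
  apply: (wavg_perturb kap_ge0 kap_oo (K := 1 + K) np_k dev_k).
  exists N => // j /= Nj; rewrite /noise_pos /noise_state Nj -/(r j) -/(x j) -/(q j).
  have -> : r j * x j - q j * g (q j) - r j * (x j - g (r j)) =
    (r j - q j) * g (r j) + q j * (g (r j) - g (q j)) by ring.
  have hL := gLip (r01 j) (q01 j Nj).
  have gr := g01' _ (r01 j); have qj := q01 j Nj.
  rewrite (le_trans (ler_normD _ _))// !normrM mulrDl mul1r lerD//.
    by rewrite ler_piMr// ger0_norm; lra.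
  by apply: le_trans hL; rewrite ler_piMl// ger0_norm; lra.
have hb' : (fun n => (c n - b n) -
    wavg kap (fun j => (1 - q j) * (1 - g (q j))) n) @ \oo --> (0 : R).
  under eq_fun do rewrite cbE.
  have nz : wavg kap (fun j => noise_pos j w + -1 * noise_state j w) @ \oo --> (0 : R).
    have -> : wavg kap (fun j => noise_pos j w + -1 * noise_state j w) =
        fun n => wavg kap (noise_pos^~ w) n - wavg kap (noise_state^~ w) n.
      by apply/funext => n; rewrite wavgD wavgZ mulN1r.
    by rewrite -[0]subr0; apply: cvgB.
  apply: (wavg_perturb kap_ge0 kap_oo (K := 1 + K) nz dev_k).
  exists N => // j /= Nj; rewrite /noise_pos /noise_state Nj -/(r j) -/(x j) -/(q j).
  have -> : (1 - r j) * (1 - x j) - (1 - q j) * (1 - g (q j)) -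
      (r j * (x j - g (r j)) + -1 * (x j - g (r j))) =
    - ((r j - q j) * (1 - g (r j)) + (1 - q j) * (g (r j) - g (q j))) by ring.
  have hL := gLip (r01 j) (q01 j Nj).
  have gr := g01' _ (r01 j); have qj := q01 j Nj.
  rewrite normrN (le_trans (ler_normD _ _))// !normrM mulrDl mul1r lerD//.
    by rewrite ler_piMr// ger0_norm; lra.
  by apply: le_trans hL; rewrite ler_piMl// ger0_norm; lra.
have x01 j : 0 <= x j <= 1 by rewrite /x; case: (X _ _) => /=; lra.
have hq : \forall n \near \oo, [/\ 0 <= q n <= 1, 0 <= b n, 0 <= c n - b n,
    b n + (c n - b n) <= 1 & q n * (b n + (c n - b n) + alpha) = b n + alpha * a n].
  exists N.+1 => // n /= Nn.
  have s0 : (0 : R) < (s_ N k n)%:R.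
    rewrite s_sum; case: n Nn => // n; rewrite ltnS => Nn; rewrite big_ord_recr /= /kap Nn.
    rewrite ltr_wpDl ?ltr0n ?hk//; apply: sumr_ge0 => j _; exact: kap_ge0.
  have n0 : (0 : R) < n%:R by rewrite ltr0n; lia.
  split.
  - by apply: q01; exact: ltnW.
  - by rewrite divr_ge0.
  - rewrite cbE /wavg divr_ge0 ?sumr_ge0// => j _; rewrite ?kap_ge0//.
    by have := r01 j; have := x01 j => ? ?; rewrite !mulr_ge0 ?kap_ge0//; lra.
  - rewrite cbE bE -wavgD /wavg -s_sum ler_pdivrMr// mul1r s_sum.
    apply: ler_sum => j _; rewrite ler_piMr ?kap_ge0//.
    by have := r01 j; rewrite /x; case: (X _ _) => /=; lra.
  - have := draw_shareE w (ltnW Nn); rewrite -/(q n) beta_s// => E.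
    have bn : beta n = alpha * (s_ N k n)%:R / n%:R.
      by rewrite -beta_s// mulrAC divff ?mul1r// gt_eqF.
    rewrite bn in E; have -> : b n + (c n - b n) = c n by ring.
    apply: (mulIf (lt0r_neq0 s0)); rewrite /a /b /c.
    transitivity (q n * ((C_ N k X U n w)%:R + alpha * (s_ N k n)%:R)).
      by field; rewrite gt_eqF.
    by rewrite E; field; rewrite !gt_eqF.
have [ca cb cb'] := mean_field_cvg alpha0 g01' gmono gLip g0 g1 qs01 Ghat_uniq
  kap_ge0 kap_oo (fun=> ler01) one_oo ha hb hb' hq.
split=> //.
have -> : (fun n => (C_ N k X U n w)%:R / (s_ N k n)%:R) =
    fun n => b n + (c n - b n) by apply/funext => n; rewrite addrC subrK.
exact: cvgD.
Qed.

Lemma stat_cvg_ae : {ae P, forall w,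
  [/\ (A_ X n w)%:R / n%:R @[n --> \oo] --> g qs,
      (B_ N k X U n w)%:R / (s_ N k n)%:R @[n --> \oo] --> qs * g qs &
      (C_ N k X U n w)%:R / (s_ N k n)%:R @[n --> \oo] -->
        qs * g qs + (1 - qs) * (1 - g qs)]}.
Proof.
have up n Z : known n n Z -> known n n.+1 Z by exact: known_le.
have h1 := noise_lln known_noise_state noise_state_le1
  (fun n Z kZ => noise_state_orthogonal (up n Z kZ)).
have h2 := noise_lln known_noise_pos noise_pos_le1
  (fun n Z kZ => noise_pos_orthogonal (up n Z kZ)).
have h3 := noise_lln known_noise_sampling noise_sampling_le1 noise_sampling_orthogonal.
apply: filterS3 h1 h2 h3 => w [s_k s_1] [p_k _] [v_k v_1].
exact: stat_cvg_pathwise.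
Qed.

End GrowingModel.

(** * Convergence to the equilibrium *)

Lemma reinf01 {R : realType} (p : R) f : p \in `[0, 1] ->
  (forall x, x \in `[0, 1] -> f x \in `[0, 1]) ->
  forall x : R, 0 <= x <= 1 -> 0 <= reinf p f x <= 1.
Proof.
rewrite in_itv /= => p01 f01 x x01.
have := f01 x; rewrite !in_itv /= => /(_ x01) fx; rewrite /reinf.
have h1 : 0 <= p * f x by rewrite mulr_ge0//; lra.
have h2 : 0 <= (1 - p) * (1 - f x) by rewrite mulr_ge0//; lra.
have h3 : p * f x <= p by rewrite ler_piMr//; lra.
have h4 : (1 - p) * (1 - f x) <= 1 - p by rewrite ler_piMr//; lra.
lra.
Qed.

(** The equation [q_alpha = qs] at the equilibrium is [Ghat qs = 0], after
    clearing the denominator. *)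
Lemma equilibrium_share {R : realType} (g : R -> R) (alpha qs : R)
    (z := (g qs, qs * g qs, qs * g qs + (1 - qs) * (1 - g qs))) :
  0 < alpha -> 0 <= qs <= 1 -> 0 <= g qs <= 1 -> Ghat g alpha qs = 0 ->
  Shat z /\ qfun alpha z = qs.
Proof.
move=> alpha0 qs01 gqs Gqs.
have b0 : 0 <= qs * g qs by rewrite mulr_ge0//; lra.
have b'0 : 0 <= (1 - qs) * (1 - g qs) by rewrite mulr_ge0//; lra.
have b1 : qs * g qs <= qs by rewrite ler_piMr//; lra.
have b'1 : (1 - qs) * (1 - g qs) <= 1 - qs by rewrite ler_piMr//; lra.
split; first by rewrite /Shat /z /=; split; rewrite ?in_itv /=; lra.
have ca : qs * g qs + (1 - qs) * (1 - g qs) + alpha != 0 by rewrite gt_eqF//; lra.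
rewrite /qfun /z; apply: (mulIf ca); rewrite divfK//.
by move: Gqs; rewrite /Ghat; lra.
Qed.

Theorem theorem4p6 (R : realType) (d : measure_display) (T : measurableType d)
  (P : probability T R) (N : nat) (k : nat -> nat) (alpha p : R) (f : R -> R)
  (beta : nat -> R) (X : nat -> {RV P >-> bool})
  (U : nat -> nat -> {RV P >-> nat}) (qs eta1 eta2 upsilon : R)
  (g := reinf p f)
  (hN : (1 <= N)%N)
  (hk : forall n, (N <= n)%N -> (0 < k n)%N)
  (hkoo : k n @[n --> \oo] --> \oo)
  (halpha : 0 < alpha)
  (hp : p \in `[0, 1]) (hp2 : p != 1 / 2)
  (hf : forall x, x \in `[0, 1] -> f x \in `[0, 1])
  (hbeta : forall n, (N <= n)%N -> 0 < beta n)
  (hbetas : forall n, (N < n)%N -> n%:R * beta n = alpha * (s_ N k n)%:R)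
  (hmodel : is_growing_model N k X U beta g)
  (hgC1 : C1_on01 g)
  (hgmono : {in `[0, 1] &, {homo g : x y / x <= y}})
  (hg0 : 0 < g 0) (hg1 : g 1 < 1)
  (hqs : qs \in `[0, 1] /\ Ghat g alpha qs = 0)
  (hqsuniq : forall q, q \in `[0, 1] -> Ghat g alpha q = 0 -> q = qs)
  (heta1 : eta1%:E = ereal_inf
     [set ((s_ N k n.+1)%:R / (n.+1%:R * (k n)%:R) : R)%:E
        | n in [set n | (N <= n)%N]])
  (heta2 : eta2%:E = ereal_sup
     [set ((s_ N k n.+1)%:R / (n.+1%:R * (k n)%:R) : R)%:E
        | n in [set n | (N <= n)%N]])
  (heta1pos : 0 < eta1) (heta2le : eta2 <= 1)
  (hups : upsilon = sup [set deriv01 g q | q in `[0, 1]%classic])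
  (hups0 : 0 < upsilon)
  (hupsle : upsilon <=
     Num.min 2 ((1 + Num.sqrt 5) * (1 - eta1)^-1 * eta1)) :
  exists L : set (R * R * R),
    [/\ compact L, connected L,
        chain_transitive (Fhat g alpha eta1 eta2) L,
        invariant_set (Fhat g alpha eta1 eta2) L &
        L `<=` Lambdahat g alpha qs] /\
    {ae P, forall w, cvg_to_set (fun n => stat N k X U n w) L}.
Proof.
have g01 : forall x : R, 0 <= x <= 1 -> 0 <= g x <= 1 := reinf01 hp hf.
have [K gLip] := C1_lipschitz hgC1.
have [qsI Gqs] := hqs.
have qs01 : 0 <= qs <= 1 by move: qsI; rewrite in_itv.
have gmono (x y : R) : 0 <= x -> x <= y -> y <= 1 -> g x <= g y.
  by move=> x0 xy y1; apply: hgmono => //; rewrite in_itv /=; lra.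
have uniq (q : R) : 0 <= q <= 1 -> Ghat g alpha q = 0 -> q = qs.
  by move=> q01; apply: hqsuniq; rewrite in_itv.
have kpos n : (N <= n)%N -> 0 < n.+1%:R * (k n)%:R :> R.
  by move=> Nn; rewrite mulr_gt0// ltr0n// hk.
have lb n : (N <= n)%N -> eta1 <= (s_ N k n.+1)%:R / (n.+1%:R * (k n)%:R).
  by move=> Nn; rewrite -lee_fin heta1; apply: ereal_inf_lbound; exists n.
have ub n : (N <= n)%N -> (s_ N k n.+1)%:R / (n.+1%:R * (k n)%:R) <= eta2.
  by move=> Nn; rewrite -lee_fin heta2; apply: ereal_sup_ubound; exists n.
have eta12 : eta1 <= eta2 := le_trans (lb N (leqnn N)) (ub N (leqnn N)).
have eta_lb n : (N <= n)%N -> eta1 * (n.+1%:R * (k n)%:R) <= (s_ N k n.+1)%:R.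
  by move=> Nn; have := lb n Nn; rewrite ler_pdivlMr// kpos.
have eta_ub n : (N <= n)%N -> (s_ N k n.+1)%:R <= n.+1%:R * (k n)%:R :> R.
  move=> Nn; have := le_trans (ub n Nn) heta2le.
  by rewrite ler_pdivrMr ?kpos// mul1r.
pose zs : R * R * R := (g qs, qs * g qs, qs * g qs + (1 - qs) * (1 - g qs)).
have [zsS zsq] : Shat zs /\ qfun alpha zs = qs.
  exact: (equilibrium_share halpha qs01 (g01 _ qs01) Gqs).
have zsF : Fhat g alpha eta1 eta2 zs 0.
  split=> //; exists eta1; first by rewrite lexx.
  by rewrite /h1 /h2 /h3 /zs -/zs zsq !subrr mulr0.
exists [set zs]; split.
  split.
  - exact: compact_set1.
  - exact: connected1.
  - exact: equilibrium_chain_transitive.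
  - exact: equilibrium_invariant.
  - by move=> _ ->.
have := stat_cvg_ae hN hk hbeta g01 hmodel heta1pos eta_lb eta_ub halpha hkoo
  hbetas gmono gLip hg0 hg1 qs01 uniq.
apply: filterS => w [ca cb cc]; apply: cvg_to_set1.
exact: (cvg_pair (cvg_pair ca cb) cc).
Qed.
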